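(* Let $n\ge 1$ and let $(M(n),\widetilde M(n))$ be either $(Q(n),\widetilde Q(n))$ or $(\mathrm{Odd}(n),\widetilde{\mathrm{Odd}}(n))$. There exist even rational functions $s_1,\dots,s_n$ on $M(n)$ without singular points on $\widetilde M(n)$ and satisfying the system of equations $$\tau_{k+n+1}=\sum_{1\le i\le n}\tau_{k+i}\,s_{n-i+1},\qquad k=0,\dots,n-1.$$ For $n>1$ there are no polynomial solutions $(s_1,\dots,s_n)$ of this system.
   Context: $Q(n)=\mathbb C^{n^2|n^2}$ is the superspace whose coordinates fill an $n\times n$ matrix $X$ of even coordinates and an $n\times n$ matrix $\xi$ of odd coordinates, combined into $A=X+\xi$. For $A=A_0+A_1$ with $A_0$ having even and $A_1$ odd entries, $\mathrm{qtr}\,A=\mathrm{tr}\,A_1$. $\mathrm{Odd}(n)=\mathbb C^{2n^2|2n^2}$ has coordinates filling a block matrix $A=\begin{pmatrix}X'&Y'\\Z'&T'\end{pmatrix}$ of $n\times n$ blocks, with $X',T'$ consisting of odd and $Y',Z'$ of even coordinates; $\mathrm{str}A=\mathrm{tr}X'+\mathrm{tr}T'$ for odd block matrices. A function on an open subsuperdomain is a polynomial in the (anticommuting) odd coordinates with coefficients functions of the even coordinates; it is rational (polynomial) if all these coefficients are rational (polynomial) functions of the even coordinates, and it has no singular points on an open set if all coefficients are regular there. For $k\ge1$, $\tau_k(A)=k^{-1}\,\mathrm{qtr}\,A^k$ on $Q(n)$ and $\tau_k(A)=(2k-1)^{-1}\,\mathrm{str}\,A^{2k-1}$ on $\mathrm{Odd}(n)$;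 these are odd polynomial functions. $\widetilde Q(n)\subset Q(n)$ is the open subsuperdomain whose underlying points are the complex matrices $X$ with $n$ pairwise distinct eigenvalues. $\widetilde{\mathrm{Odd}}(n)\subset\mathrm{Odd}(n)$ is the open subsuperdomain whose underlying points are the pairs of complex matrices $(Y',Z')$ such that $Y'Z'$ has $n$ pairwise distinct nonzero eigenvalues. *)

(* Defs.v *)
From HB Require Import structures.
From mathcomp Require Import all_boot all_order all_algebra.
From mathcomp Require Import fraction.
From mathcomp Require Import mpoly.
From mathcomp Require Import complex.
From mathcomp Require Import reals.

Set Implicit Arguments.
Unset Strict Implicit.
Unset Printing Implicit Defensive.

Import GRing.Theory.
Local Open Scope ring_scope.

(* Grassmann algebra over K on xi_0, ..., xi_(q-1): f stands for the sum over *)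
(* S = {i_1 < ... < i_r} of (f S) xi_{i_1} ... xi_{i_r}.                      *)
Definition grassmann (K : comNzRingType) (q : nat) : Type :=
  {ffun {set 'I_q} -> K}.

(* xi_A xi_B = (-1)^(inversions A B) xi_(A :|: B) for disjoint A and B. *)
Definition inversions q (A B : {set 'I_q}) : nat :=
  (\sum_(a in A) \sum_(b in B) (b < a))%N.

Section GrassmannRing.
Variables (K : comNzRingType) (q : nat).
Local Notation G := (grassmann K q).
Implicit Types (f g h : G) (A B C S : {set 'I_q}).

HB.instance Definition _ := GRing.Zmodule.copy G {ffun {set 'I_q} -> K}.

Definition gr_one : G := [ffun S : {set 'I_q} => (S == set0)%:R].

Definition gr_mul f g : G := [ffun S : {set 'I_q} =>
  \sum_(A : {set 'I_q} | A \subset S)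
     (-1) ^+ inversions A (S :\: A) * (f A * g (S :\: A))].

Definition gr_scale (c : K) f : G := [ffun S : {set 'I_q} => c * f S].

Lemma gr_addE f g S : (f + g) S = f S + g S.
Proof. exact: ffunE. Qed.

Lemma inversionsUl A B S : [disjoint A & B] ->
  inversions (A :|: B) S = (inversions A S + inversions B S)%N.
Proof.
move=> dAB; rewrite /inversions -bigU //=.
by apply: eq_bigl => a; rewrite !inE.
Qed.

Lemma inversionsUr A B S : [disjoint A & B] ->
  inversions S (A :|: B) = (inversions S A + inversions S B)%N.
Proof.
move=> dAB; rewrite /inversions -big_split /=.
apply: eq_bigr => a _; rewrite -bigU //=.
by apply: eq_bigl => b; rewrite !inE.
Qed.

Lemma inversions0l S : inversions set0 S = 0%N.
Proof. by rewrite /inversions big_set0. Qed.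

Lemma inversions0r S : inversions S set0 = 0%N.
Proof. by rewrite /inversions big1 // => a _; rewrite big_set0. Qed.

Lemma disjoint_setD A B : [disjoint A & B :\: A].
Proof. by rewrite -setI_eq0; apply/eqP/setP=> i; rewrite !inE andbA andbN. Qed.

Lemma setU_setD A B : A \subset B -> A :|: (B :\: A) = B.
Proof. by move=> AB; rewrite -{2}(setID B A) (setIidPr AB). Qed.

Lemma inversions_cocycle A B S : A \subset B -> B \subset S ->
  (inversions A (S :\: A) + inversions (B :\: A) (S :\: B))%N
    = (inversions A (B :\: A) + inversions B (S :\: B))%N.
Proof.
move=> AB BS.
have -> : S :\: A = (B :\: A) :|: (S :\: B).
  apply/setP=> i; rewrite !inE.
  move/subsetP/(_ i): AB; move/subsetP/(_ i): BS.
  by case: (i \in A) (i \in B) (i \in S) => [] [] [] // h1 h2;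
     rewrite ?(h1 isT) ?(h2 isT) //; have := h1 isT; have := h2 isT.
have dBS : [disjoint B :\: A & S :\: B].
  exact: disjointWl (subsetDl _ _) (disjoint_setD _ _).
rewrite inversionsUr // -{6}(setU_setD AB) inversionsUl ?disjoint_setD //.
by rewrite addnA.
Qed.

Lemma gr_mulA : associative gr_mul.
Proof.
move=> f g h; apply/ffunP=> S; rewrite !ffunE.
transitivity (\sum_(A : {set 'I_q} | A \subset S)
  \sum_(B : {set 'I_q} | (A \subset B) && (B \subset S))
  (-1) ^+ (inversions A (B :\: A) + inversions B (S :\: B)) *
  (f A * g (B :\: A) * h (S :\: B))).
  apply: eq_bigr => A AS; rewrite ffunE.
  rewrite (reindex_onto (fun B => B :\: A) (fun C => A :|: C)) /=; last first.
    move=> C; rewrite subsetD => /andP[_ dCA].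
    by rewrite setDUl setDv set0U; apply/setDidPl.
  rewrite !mulr_sumr; apply: eq_big => [B|B /andP[BS /eqP AB]].
    have [AB|nAB] := boolP (A \subset B); last first.
      apply/negbTE; rewrite negb_and; apply/orP; right; apply: contra nAB.
      by move/eqP <-; exact: subsetUl.
    rewrite setU_setD // eqxx andbT /=.
    apply/idP/idP=> [sB|]; last by move=> BS; exact: setSD.
    rewrite -(setU_setD AB) subUset AS /=.
    exact: subset_trans sB (subsetDl _ _).
  have sAB : A \subset B by rewrite -AB subsetUl.
  have sBS : B \subset S.
    by rewrite -AB subUset AS (subset_trans BS) ?subsetDl.
  rewrite setDDl setU_setD // -inversions_cocycle // exprD.
  by rewrite -!mulrA; congr (_ * _); rewrite mulrCA.
rewrite (exchange_big_dep (fun B => B \subset S)) /=; last first.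
  by move=> A B _ /andP[].
apply: eq_bigr => B BS; rewrite ffunE mulr_suml mulr_sumr.
apply: eq_big => [A|A _].
  rewrite BS andbT; case: (boolP (A \subset B)) => [AB|]; rewrite ?andbF //.
  by rewrite (subset_trans AB BS).
by rewrite exprD -!mulrA mulrCA.
Qed.

Lemma gr_mul1 : left_id gr_one gr_mul.
Proof.
move=> f; apply/ffunP=> S; rewrite ffunE (bigD1 set0) ?sub0set //=.
rewrite setD0 inversions0l ffunE eqxx !mul1r big1 ?addr0 // => A /andP[_ nA].
by rewrite ffunE (negbTE nA) mul0r mulr0.
Qed.

Lemma gr_mulr1 : right_id gr_one gr_mul.
Proof.
move=> f; apply/ffunP=> S; rewrite ffunE (bigD1 S) //=.
rewrite setDv inversions0r ffunE eqxx mul1r mulr1 big1 ?addr0 //.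
move=> A /andP[AS nA]; rewrite ffunE setD_eq0.
case: (boolP (S \subset A)) => [SA|_]; last by rewrite !mulr0.
by rewrite eqEsubset AS SA in nA.
Qed.

Lemma gr_mulDl : left_distributive gr_mul +%R.
Proof.
move=> f g h; apply/ffunP=> S; rewrite gr_addE !ffunE -big_split /=.
by apply: eq_bigr => A _; rewrite gr_addE mulrDl mulrDr.
Qed.

Lemma gr_mulDr : right_distributive gr_mul +%R.
Proof.
move=> f g h; apply/ffunP=> S; rewrite gr_addE !ffunE -big_split /=.
by apply: eq_bigr => A _; rewrite gr_addE !mulrDr.
Qed.

Lemma gr_one_neq0 : gr_one != 0.
Proof.
apply/eqP=> /ffunP/(_ set0); rewrite !ffunE eqxx; apply/eqP.
exact: oner_neq0.
Qed.

HB.instance Definition _ := GRing.Zmodule_isNzRing.Build G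
  gr_mulA gr_mul1 gr_mulr1 gr_mulDl gr_mulDr gr_one_neq0.

Lemma gr_mulE f g S : (f * g) S = \sum_(A : {set 'I_q} | A \subset S)
  (-1) ^+ inversions A (S :\: A) * (f A * g (S :\: A)).
Proof. exact: ffunE. Qed.

Lemma gr_scaleA c d f : gr_scale c (gr_scale d f) = gr_scale (c * d) f.
Proof. by apply/ffunP=> S; rewrite !ffunE mulrA. Qed.

Lemma gr_scale1 : left_id 1 gr_scale.
Proof. by move=> f; apply/ffunP=> S; rewrite !ffunE mul1r. Qed.

Lemma gr_scaleDr : right_distributive gr_scale +%R.
Proof.
by move=> c f g; apply/ffunP=> S; rewrite gr_addE !ffunE mulrDr.
Qed.

Lemma gr_scaleDl f : {morph gr_scale^~ f : c d / c + d}.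
Proof. by move=> c d; apply/ffunP=> S; rewrite gr_addE !ffunE mulrDl. Qed.

HB.instance Definition _ := GRing.Zmodule_isLmodule.Build K G
  gr_scaleA gr_scale1 gr_scaleDr gr_scaleDl.

Lemma gr_scaleE c f S : (c *: f) S = c * f S.
Proof. exact: ffunE. Qed.

Lemma gr_scaleAl (c : K) f g : c *: (f * g) = (c *: f) * g.
Proof.
apply/ffunP=> S; rewrite gr_scaleE !gr_mulE mulr_sumr.
by apply: eq_bigr => A _; rewrite gr_scaleE -mulrA mulrCA.
Qed.

HB.instance Definition _ := GRing.Lmodule_isLalgebra.Build K G gr_scaleAl.

Lemma gr_scaleAr (c : K) f g : c *: (f * g) = f * (c *: g).
Proof.
apply/ffunP=> S; rewrite gr_scaleE !gr_mulE mulr_sumr.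
by apply: eq_bigr => A _; rewrite gr_scaleE mulrCA [c * (_ * _)]mulrCA.
Qed.

HB.instance Definition _ := GRing.Lalgebra_isAlgebra.Build K G gr_scaleAr.

Definition gr_gen (i : 'I_q) : G := [ffun S : {set 'I_q} => (S == [set i])%:R].

Lemma gr_gen_mul (i j : 'I_q) : gr_gen i * gr_gen j =
  (-1) ^+ (j < i) *:
    ([ffun S : {set 'I_q} => ((i != j) && (S == [set i; j]))%:R] : G).
Proof.
apply/ffunP=> S; rewrite gr_scaleE gr_mulE ffunE.
have [iS|niS] := boolP (i \in S); last first.
  rewrite big1 => [|A AS].
    have [SE|_] := eqVneq S [set i; j]; last by rewrite andbF mulr0.
    by rewrite SE !inE eqxx in niS.
  rewrite ffunE; have [AE|_] := eqVneq A [set i]; last by rewrite mul0r mulr0.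
  by rewrite -sub1set -AE AS in niS.
rewrite (bigD1 [set i]) ?sub1set //= [X in _ + X]big1 ?addr0; last first.
  by move=> A /andP[_ nA]; rewrite ffunE (negbTE nA) mul0r mulr0.
rewrite !ffunE eqxx mul1r.
have -> : (S :\ i == [set j]) = (i != j) && (S == [set i; j]).
  apply/eqP/andP=> [SE|[ij /eqP->]].
    rewrite -(setD1K iS) SE eqxx; split=> //.
    have: j \in S :\ i by rewrite SE set11.
    by rewrite !inE eq_sym => /andP[].
  by apply/setP=> x; rewrite !inE; case: eqVneq => // ->; rewrite (negbTE ij).
case: andP => [[ij /eqP->]|_]; last by rewrite !mulr0.
have -> : [set i; j] :\ i = [set j].
  by apply/setP=> x; rewrite !inE; case: eqVneq => // ->; rewrite (negbTE ij).
by rewrite /inversions !big_set1.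
Qed.

Lemma gr_gen_anticomm (i j : 'I_q) :
  gr_gen j * gr_gen i = - (gr_gen i * gr_gen j).
Proof.
rewrite !gr_gen_mul setUC eq_sym.
case: ltngtP => [||/ord_inj->];
  rewrite ?expr0 ?expr1 ?scale1r ?scaleN1r ?opprK //.
by apply/ffunP=> S; rewrite eqxx /=; rewrite !ffunE oppr0.
Qed.

Definition gr_odd_part f : G :=
  [ffun S : {set 'I_q} => if odd #|S| then f S else 0].

Definition gr_even f : Prop := forall S, odd #|S| -> f S = 0.

End GrassmannRing.

(* Rational functions on C^{p|q}: the coefficients of the monomials in the    *)
(* odd coordinates are rational functions of the p even coordinates.          *)
Notation ratfun C p q := (grassmann {fraction {mpoly C[p]}} q).

Section RationalFunctions.
Variables (C : fieldType) (p q : nat).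

Definition even_coord (i : 'I_p) : ratfun C p q :=
  (tofrac ('X_i : {mpoly C[p]}))%:A.

Definition odd_coord (i : 'I_q) : ratfun C p q := gr_gen _ i.

Definition regular_at (phi : {fraction {mpoly C[p]}}) (x : 'rV[C]_p) : Prop :=
  exists f g : {mpoly C[p]}, g.@[x 0] != 0 /\ phi = tofrac f / tofrac g.

Definition no_singular_points (U : 'rV[C]_p -> Prop) (s : ratfun C p q) :=
  forall (S : {set 'I_q}) (x : 'rV[C]_p), U x -> regular_at (s S) x.

Definition polynomial_fun (s : ratfun C p q) : Prop :=
  forall S : {set 'I_q}, exists f : {mpoly C[p]}, s S = tofrac f.

End RationalFunctions.

Section Superspaces.
Variables (C : fieldType) (n : nat).

Definition qtr (K : comNzRingType) (q m : nat) (A : 'M[grassmann K q]_m) :=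
  \tr (map_mx (@gr_odd_part K q) A).

(* X_ij and xi_ij are the coordinates numbered mxvec_index i j. *)
Definition Q_matrix : 'M[ratfun C (n * n) (n * n)]_n :=
  \matrix_(i, j) (even_coord C _ (mxvec_index i j)
                  + odd_coord C _ (mxvec_index i j)).

Definition Q_tau (k : nat) : ratfun C (n * n) (n * n) :=
  k%:R^-1 *: qtr (Q_matrix ^+ k).

Definition Q_tilde (x : 'rV[C]_(n * n)) : Prop :=
  exists e : n.-tuple C, uniq e /\ all (eigenvalue (vec_mx x)) e.

(* The supertrace of a supermatrix whose diagonal blocks have odd entries and *)
(* whose off-diagonal blocks have even entries (hence no minus sign).         *)
Definition odd_str (V : nmodType) (m : nat) (A : 'M[V]_(m + m)) : V :=
  \tr (ulsubmx A) + \tr (drsubmx A).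

(* The first n * n even (resp. odd) coordinates fill Y' (resp. X'), the last  *)
(* n * n fill Z' (resp. T').                                                  *)
Definition Odd_matrix : 'M[ratfun C (n * n + n * n) (n * n + n * n)]_(n + n) :=
  block_mx
    (\matrix_(i, j) odd_coord C _ (lshift _ (mxvec_index i j)))
    (\matrix_(i, j) even_coord C _ (lshift _ (mxvec_index i j)))
    (\matrix_(i, j) even_coord C _ (rshift _ (mxvec_index i j)))
    (\matrix_(i, j) odd_coord C _ (rshift _ (mxvec_index i j))).

Definition Odd_tau (k : nat) : ratfun C (n * n + n * n) (n * n + n * n) :=
  (2 * k - 1)%:R^-1 *: odd_str (Odd_matrix ^+ (2 * k - 1)).

Definition Odd_tilde (x : 'rV[C]_(n * n + n * n)) : Prop :=
  exists e : n.-tuple C, [/\ uniq e, 0 \notin e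
    & all (eigenvalue (vec_mx (lsubmx x) *m vec_mx (rsubmx x))) e].

End Superspaces.

Variant superspace := Q | Odd.

(* M(n) is C^{d|d} for d := superdim M n. *)
Definition superdim (M : superspace) (n : nat) : nat :=
  match M with Q => n * n | Odd => n * n + n * n end.

Definition tau (C : fieldType) (M : superspace) (n : nat) :
    nat -> ratfun C (superdim M n) (superdim M n) :=
  match M with Q => @Q_tau C n | Odd => @Odd_tau C n end.

Definition tilde (C : fieldType) (M : superspace) (n : nat) :
    'rV[C]_(superdim M n) -> Prop :=
  match M with Q => @Q_tilde C n | Odd => @Odd_tilde C n end.

(* Main.v *)
(* Existence.  Let A = X + N with N odd, over the ring of rational functions
   regular on the open set, and let p be the characteristic polynomial of X.
   As p'(X) is invertible, every matrix M differs from one commuting with X,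
   namely sum_k p_k sum_(i+j=k-1) X^i M p'(X)^-1 X^j, by a commutator [X, r].
   Conjugating by 1 - r with r of increasing Grassmann degree turns A into
   X + C with C commuting with X.  Since X has a cyclic vector, homogeneous
   matrices commuting with X supercommute; hence the even part Y and the odd
   part Z of X + C satisfy YZ = ZY and Z^2 = 0, so that
   qtr A^k = k tr(Y^(k-1) Z), and the Cayley-Hamilton relation for Y is the
   required recursion.  A matrix of Odd(n) is a point of Q(2n) all of whose even
   powers have qtr 0, so every other term of the recursion for Q(2n) vanishes.

   Nonexistence.  Evaluate a polynomial solution at a point with eigenvalues
   1, 1, 2, ..., n-1 and let P = t^n - sum_j s_(n-j) t^j, constant terms of the
   s_j only.  The coefficients of the diagonal odd coordinates give P(i) = 0 for
   0 < i < n.  If (a b; c d) is the odd block at the double eigenvalue, comparing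
   the coefficients of abc and dcb gives P'(1) = P''(1) = 0: too many roots. *)
Require Import Defs.
From HB Require Import structures.
From mathcomp Require Import all_boot all_order all_algebra.
From mathcomp Require Import fraction.
From mathcomp Require Import mpoly.
From mathcomp Require Import complex.
From mathcomp Require Import boolp reals.
From mathcomp Require Import separable.
From mathcomp Require Import zify ring ssrAC.

Set Implicit Arguments.
Unset Strict Implicit.
Unset Printing Implicit Defensive.

Import Order.TTheory GRing.Theory Num.Theory.
Local Open Scope ring_scope.

(** * Parity and degree in the Grassmann algebra *)

Section Grading.
Variables (K : comNzRingType) (q : nat).
Local Notation G := (grassmann K q).
Implicit Types (f g : G) (A B S : {set 'I_q}).

Lemma gr_0E S : (0 : G) S = 0. Proof. exact: ffunE. Qed.
Lemma gr_oppE f S : (- f) S = - f S. Proof. exact: ffunE. Qed.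
Lemma gr_1E S : (1 : G) S = (S == set0)%:R. Proof. exact: ffunE. Qed.
Lemma gr_genE i S : gr_gen K i S = (S == [set i])%:R. Proof. exact: ffunE. Qed.

Lemma gr_sumE (I : Type) (r : seq I) (P : pred I) (F : I -> G) S :
  (\sum_(i <- r | P i) F i) S = \sum_(i <- r | P i) F i S.
Proof.
elim/big_rec2: _ => [|i x y _ <-]; first exact: gr_0E.
by rewrite gr_addE.
Qed.

Lemma gr_scalarC (c : K) f : c%:A * f = f * c%:A.
Proof. by rewrite -scalerAl mul1r -scalerAr mulr1. Qed.

(** Zero is homogeneous of both parities, which keeps homogeneity stable under sums. *)
Definition gr_par (b : bool) f : Prop := forall S, odd #|S| != b -> f S = 0.

(** Membership in the [d]-th power of the ideal generated by the odd coordinates. The filtration is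
    zero from degree [q.+1] on, so that successive conjugations come to an end. *)
Definition gr_ge (d : nat) f : Prop := forall S, (#|S| < d)%N -> f S = 0.

Definition gr_part (b : bool) f : G :=
  [ffun S : {set 'I_q} => if odd #|S| == b then f S else 0].

Lemma gr_partE b f S : gr_part b f S = if odd #|S| == b then f S else 0.
Proof. exact: ffunE. Qed.

Lemma gr_odd_partE f : gr_odd_part f = gr_part true f.
Proof. by apply/ffunP=> S; rewrite gr_partE ffunE eqb_id. Qed.

Lemma gr_even_par f : gr_even f <-> gr_par false f.
Proof.
by split=> H S HS; apply: H; move: HS; rewrite ?eqbF_neg ?negbK.
Qed.

Lemma gr_part_is_zmod_morphism b : zmod_morphism (gr_part b).
Proof.
move=> f g; apply/ffunP=> S; rewrite gr_addE gr_oppE !gr_partE gr_addE gr_oppE.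
by case: ifP => _ //; rewrite subr0.
Qed.

HB.instance Definition _ b :=
  GRing.isZmodMorphism.Build G G (gr_part b) (gr_part_is_zmod_morphism b).

Lemma gr_odd_part_is_zmod_morphism : zmod_morphism (@gr_odd_part K q).
Proof. by move=> f g; rewrite !gr_odd_partE raddfB. Qed.

HB.instance Definition _ :=
  GRing.isZmodMorphism.Build G G (@gr_odd_part K q) gr_odd_part_is_zmod_morphism.

Lemma gr_part_par b f : gr_par b (gr_part b f).
Proof. by move=> S; rewrite gr_partE => /negbTE ->. Qed.

Lemma gr_part_id b f : gr_par b f -> gr_part b f = f.
Proof.
by move=> H; apply/ffunP=> S; rewrite gr_partE; case: eqP => // /eqP /H ->.
Qed.

Lemma gr_part_neq b f : gr_par b f -> gr_part (~~ b) f = 0.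
Proof.
move=> H; apply/ffunP=> S; rewrite gr_partE gr_0E; case: eqP => // HS.
by rewrite H // HS; case: (b).
Qed.

Lemma gr_part_sum f : f = gr_part false f + gr_part true f.
Proof.
apply/ffunP=> S; rewrite gr_addE !gr_partE.
by case: (odd _); rewrite /= ?add0r ?addr0.
Qed.

Lemma gr_par0 b : gr_par b 0. Proof. by move=> S _; rewrite gr_0E. Qed.

Lemma gr_par1 : gr_par false 1.
Proof.
by move=> S; rewrite gr_1E; have [->|//] := eqVneq S set0; rewrite cards0.
Qed.

Lemma gr_parD b f g : gr_par b f -> gr_par b g -> gr_par b (f + g).
Proof. by move=> Hf Hg S HS; rewrite gr_addE Hf // Hg // addr0. Qed.

Lemma gr_parN b f : gr_par b f -> gr_par b (- f).
Proof. by move=> Hf S HS; rewrite gr_oppE Hf // oppr0. Qed.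

Lemma gr_parZ b c f : gr_par b f -> gr_par b (c *: f).
Proof. by move=> Hf S HS; rewrite gr_scaleE Hf // mulr0. Qed.

Lemma gr_par_sum b (I : Type) (r : seq I) (P : pred I) (F : I -> G) :
  (forall i, P i -> gr_par b (F i)) -> gr_par b (\sum_(i <- r | P i) F i).
Proof.
by move=> H; elim/big_rec: _ => [|i x Pi Hx]; [exact: gr_par0 | apply: gr_parD (H i Pi) Hx].
Qed.

Lemma gr_par_gen i : gr_par true (gr_gen K i).
Proof.
by move=> S; rewrite gr_genE; have [->|//] := eqVneq S [set i]; rewrite cards1.
Qed.

Lemma gr_parM b c f g : gr_par b f -> gr_par c g -> gr_par (b (+) c) (f * g).
Proof.
move=> Hf Hg S HS; rewrite gr_mulE big1 // => A AS.
have cS : #|S| = (#|A| + #|S :\: A|)%N by rewrite -(cardsID A S) (setIidPr AS).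
have [HA|/Hf->] := eqVneq (odd #|A|) b; last by rewrite mul0r mulr0.
rewrite Hg ?mulr0 //; apply: contraNneq HS => HB.
by rewrite cS oddD HA HB.
Qed.

(** Each pair of an element of [A] and one of [B] is an inversion in exactly one of the two
    orders. *)
Lemma inversions_sym A B : [disjoint A & B] ->
  (inversions A B + inversions B A = #|A| * #|B|)%N.
Proof.
move=> dAB; rewrite /inversions [X in (_ + X)%N]exchange_big -big_split /=.
rewrite -sum_nat_const; apply: eq_bigr => a Aa.
rewrite -big_split -sum1_card /=; apply: eq_bigr => b Bb.
have : (a : nat) != b by apply: contraTneq Bb => /ord_inj <-; rewrite (disjointFr dAB).
by case: ltngtP.
Qed.

(** Replacing [A] by its complement in [S] matches the terms of the two products. By
    [inversions_sym] the signs differ by (-1)^(|A| |S - A|), which depends only on the parities of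
    the factors. *)
Lemma gr_par_comm b c f g : gr_par b f -> gr_par c g ->
  f * g = (-1) ^+ (b && c) *: (g * f).
Proof.
move=> Hf Hg; apply/ffunP=> S; rewrite gr_scaleE !gr_mulE.
rewrite (reindex_onto (fun A => S :\: A) (fun A => S :\: A)) /=; last first.
  by move=> A AS; rewrite setDDr setDv set0U (setIidPr AS).
rewrite mulr_sumr; apply: eq_big => [A|A /andP[_ /eqP AS]].
  rewrite subsetDl /= setDDr setDv set0U.
  by apply/eqP/idP => [/setIidPr|/setIidPr] //.
have sAS : A \subset S by rewrite -AS subsetDl.
rewrite AS; have [HA|/Hg->] := eqVneq (odd #|A|) c; last by rewrite !(mulr0, mul0r).
have [HB|/Hf->] := eqVneq (odd #|S :\: A|) b; last by rewrite !(mulr0, mul0r).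
rewrite -HA -HB -oddM mulnC.
rewrite -(inversions_sym (disjoint_setD A S)) signr_odd exprD.
rewrite [f _ * _]mulrC !mulrA; congr (_ * _ * _).
by rewrite -mulrA mulrCA -expr2 sqrr_sign mulr1.
Qed.

Lemma gr_ge0 d : gr_ge d 0. Proof. by move=> S _; rewrite gr_0E. Qed.

Lemma gr_geD d f g : gr_ge d f -> gr_ge d g -> gr_ge d (f + g).
Proof. by move=> Hf Hg S HS; rewrite gr_addE Hf // Hg // addr0. Qed.

Lemma gr_geN d f : gr_ge d f -> gr_ge d (- f).
Proof. by move=> Hf S HS; rewrite gr_oppE Hf // oppr0. Qed.

Lemma gr_geW d e f : (e <= d)%N -> gr_ge d f -> gr_ge e f.
Proof. by move=> ed Hf S HS; apply: Hf; apply: leq_trans ed. Qed.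

Lemma gr_ge_all f : gr_ge 0 f. Proof. by []. Qed.

Lemma gr_ge_nil f : gr_ge q.+1 f -> f = 0.
Proof.
move=> H; apply/ffunP=> S; rewrite gr_0E H // ltnS.
by rewrite -[X in (_ <= X)%N]card_ord max_card.
Qed.

Lemma gr_geM d e f g : gr_ge d f -> gr_ge e g -> gr_ge (d + e) (f * g).
Proof.
move=> Hf Hg S HS; rewrite gr_mulE big1 // => A AS.
have cS : #|S| = (#|A| + #|S :\: A|)%N by rewrite -(cardsID A S) (setIidPr AS).
have [dA|/Hf->] := leqP d #|A|; last by rewrite mul0r mulr0.
rewrite Hg ?mulr0 //; rewrite cS in HS.
by rewrite -(ltn_add2l d); apply: leq_ltn_trans HS; rewrite leq_add2r.
Qed.

Lemma gr_par_true_ge1 f : gr_par true f -> gr_ge 1 f.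
Proof.
move=> H S; rewrite ltnS leqn0 cards_eq0 => /eqP ->.
by apply: H; rewrite cards0.
Qed.

(** An odd function has no constant term, so the other splitting of the singleton contributes
    nothing. *)
Lemma gr_mulf_S1 f g i : gr_par true f -> (f * g) [set i] = f [set i] * g set0.
Proof.
move=> Hf; rewrite gr_mulE (bigD1 [set i]) //= setDv inversions0r mul1r.
rewrite big1 ?addr0 // => A /andP[]; rewrite subset1 => /orP[->//|/eqP-> _].
by rewrite Hf ?cards0 // mul0r mulr0.
Qed.

Lemma gr_genM i f S : i \in S ->
  (gr_gen K i * f) S = (-1) ^+ inversions [set i] (S :\ i) * f (S :\ i).
Proof.
move=> iS; rewrite gr_mulE (bigD1 [set i]) ?sub1set //= gr_genE eqxx mul1r.
rewrite big1 ?addr0 // => A /andP[_ nA].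
by rewrite gr_genE (negbTE nA) mul0r mulr0.
Qed.

Lemma gr_gen_sq (i : 'I_q) : gr_gen K i * gr_gen K i = 0.
Proof.
rewrite gr_gen_mul eqxx; apply/ffunP=> S; rewrite [RHS]gr_0E gr_scaleE ffunE.
by rewrite mulr0.
Qed.

End Grading.

(** * Conjugation into the commutant of the body *)

Section AdSplitting.
Variables (T : pzRingType) (X : T) (I : T -> Prop).
Hypothesis I0 : I 0.
Hypothesis ID : forall a b, I a -> I b -> I (a + b).
Hypothesis IXl : forall a, I a -> I (X * a).
Hypothesis IXr : forall a, I a -> I (a * X).

Let ad_sum a b : X * (a + b) - (a + b) * X = (X * a - a * X) + (X * b - b * X).
Proof. by rewrite mulrDr mulrDl opprD addrACA. Qed.

(** Take for [D] the sum of X^i M X^j over i + j = k - 1. Its commutator with [X] telescopes, and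
    moving each X^i to the right of [M] costs a commutator with [X]; these add up to [X, r]. The
    predicate [I] will be a bound on the Grassmann degree. *)
Lemma ad_split_monomial M k : I M ->
  exists D r, [/\ I D, I r, X * D - D * X = X ^+ k * M - M * X ^+ k
    & D = M * X ^+ k.-1 *+ k + (X * r - r * X)].
Proof.
move=> IM; have IMX j : I (M * X ^+ j).
  by elim: j => [|j IH]; rewrite ?mulr1 // exprSr mulrA; apply: IXr.
elim: k => [|k [D [r [iD ir adD defD]]]].
  by exists 0, 0; rewrite !(mulr0, mul0r, mulr0n, mul1r, mulr1, subrr, addr0); split.
exists (X * D + M * X ^+ k), (r * X + D); split.
- by apply: ID; [apply: IXl | apply: IMX].
- by apply: ID => //; apply: IXr.
- rewrite ad_sum -!mulrA -mulrBr adD mulrBr !mulrA -exprS addrA subrK.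
  by rewrite -mulrA -exprSr.
- have -> : X * D + M * X ^+ k = D * X + (X * D - D * X) + M * X ^+ k.
    by rewrite [D * X + _]addrC subrK.
  have DX : D * X = M * X ^+ k *+ k + (X * (r * X) - r * X * X).
    rewrite {1}defD mulrDl mulrBl !mulrA; congr (_ + _).
    case: (k) => [|j]; rewrite ?mulr0n ?mul0r //=.
    by rewrite mulrnAl -mulrA -exprSr.
  rewrite ad_sum mulrSr /= {1}DX.
  move: (X * (r * X) - _) (X * D - _) (M * _) => b e f.
  by rewrite -[f *+ k + b + e]addrA addrAC.
Qed.

Variable c : nat -> T.
Hypothesis cC : forall k a, c k * a = a * c k.
Hypothesis Ic : forall k a, I a -> I (c k * a).

(** The monomial case summed with central coefficients: one sum is a polynomial p at [X], the one in
    the formula for [D] is p'(X). *)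
Lemma ad_split_poly M n : I M ->
  exists D r, [/\ I D, I r,
    X * D - D * X = (\sum_(k < n) c k * X ^+ k) * M - M * (\sum_(k < n) c k * X ^+ k)
    & D = M * (\sum_(k < n) c k * X ^+ k.-1 *+ k) + (X * r - r * X)].
Proof.
move=> IM; elim: n => [|n [D [r [iD ir adD defD]]]].
  by exists 0, 0; rewrite !big_ord0 !(mulr0, mul0r, subrr, addr0); split.
have [D' [r' [iD' ir' adD' defD']]] := ad_split_monomial n IM.
have ad_c a : X * (c n * a) - c n * a * X = c n * (X * a - a * X).
  by rewrite mulrA -cC mulrBr !mulrA.
exists (D + c n * D'), (r + c n * r'); rewrite !big_ord_recr /=; split.
- by apply: ID => //; apply: Ic.
- by apply: ID => //; apply: Ic.
- rewrite ad_sum ad_c adD adD' mulrBr [in RHS]mulrDl [in RHS]mulrDr opprD addrACA.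
  by congr (_ + (_ - _)); rewrite !mulrA // cC.
- rewrite ad_sum ad_c {1}defD {1}defD' (mulrDr (c n)) (mulrDr M) [LHS]addrACA.
  congr (_ + _ + _).
  by rewrite -!mulrnAr mulrA cC -mulrA.
Qed.

(** Apply [ad_split_poly] to [N * V]: p(X) = 0 makes [D] commute with [X], and N V p'(X) = N. *)
Lemma ad_split n V N :
    \sum_(k < n) c k * X ^+ k = 0 ->
    V * (\sum_(k < n) c k * X ^+ k.-1 *+ k) = 1 ->
    (forall a, I a -> I (a * V)) -> I N ->
  exists D r, [/\ I D, I r, X * D = D * X & D = N + (X * r - r * X)].
Proof.
move=> P0 VP' IV IN.
have [D [r [iD ir adD defD]]] := ad_split_poly n (IV _ IN).
rewrite P0 mul0r mulr0 subrr in adD; rewrite -mulrA VP' mulr1 in defD.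
by exists D, r; split=> //; apply: subr0_eq.
Qed.

End AdSplitting.

Section MatrixGrading.
Variables (K : comNzRingType) (q m : nat).
Local Notation G := (grassmann K q).
Implicit Types (A B : 'M[G]_m).

Definition mx_par b A := forall i j, gr_par b (A i j).
Definition mx_ge d A := forall i j, gr_ge d (A i j).
Definition gr_lift (X : 'M[K]_m) : 'M[G]_m := map_mx (in_alg G) X.

Lemma mx_ge0 d : mx_ge d 0. Proof. by move=> i j; rewrite mxE; apply: gr_ge0. Qed.

Lemma mx_geD d A B : mx_ge d A -> mx_ge d B -> mx_ge d (A + B).
Proof. by move=> HA HB i j; rewrite mxE; apply: gr_geD. Qed.

Lemma mx_geN d A : mx_ge d A -> mx_ge d (- A).
Proof. by move=> HA i j; rewrite mxE; apply: gr_geN. Qed.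

Lemma mx_geM d e A B : mx_ge d A -> mx_ge e B -> mx_ge (d + e) (A * B).
Proof.
move=> HA HB i j; rewrite mxE; elim/big_rec: _ => [|l x _ Hx]; first exact: gr_ge0.
by apply: gr_geD Hx; apply: gr_geM.
Qed.

Lemma mx_geMl d A B : mx_ge d B -> mx_ge d (A * B).
Proof. by move=> HB; apply: (@mx_geM 0 d) HB => i j; apply: gr_ge_all. Qed.

Lemma mx_geMr d A B : mx_ge d A -> mx_ge d (A * B).
Proof. by move=> HA; rewrite -[d]addn0; apply: mx_geM => // i j; apply: gr_ge_all. Qed.

Lemma mx_geW d e A : (e <= d)%N -> mx_ge d A -> mx_ge e A.
Proof. by move=> ed HA i j; apply: gr_geW (HA i j). Qed.

Lemma mx_ge_nil A : mx_ge q.+1 A -> A = 0.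
Proof. by move=> HA; apply/matrixP=> i j; rewrite mxE; apply: gr_ge_nil. Qed.

(** The geometric series in [- r] is finite, since [(- r) ^+ q.+1] has degree above [q]. *)
Lemma mx_ge_unipotent r : mx_ge 1 r ->
  exists h, (1 + r) * h = 1 /\ h * (1 + r) = 1.
Proof.
move=> Hr; pose h := \sum_(i < q.+1) (- r) ^+ i.
have Hk k : mx_ge k ((- r) ^+ k).
  elim: k => [|k IH]; first by move=> i j; apply: gr_ge_all.
  by rewrite exprS; apply: (@mx_geM 1 k) IH; apply: mx_geN.
have r0 : (- r) ^+ q.+1 = 0 by apply: mx_ge_nil.
have rh : (1 + r) * h = 1.
  apply: oppr_inj; rewrite -mulNr opprD addrC -(subrX1 (- r) q.+1) r0.
  by rewrite sub0r.
exists h; split=> //; rewrite -[RHS]rh.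
rewrite /h mulr_suml mulr_sumr; apply: eq_bigr => i _.
have : GRing.comm (1 + r) ((- r) ^+ i).
  by apply/commrX/commrN/commr_sym/commrD; [apply: commr1 | apply: commr_refl].
by move=> <-.
Qed.

Lemma mx_par_ge1 A : mx_par true A -> mx_ge 1 A.
Proof. by move=> HA i j; apply: gr_par_true_ge1. Qed.

Lemma gr_liftM X Y : gr_lift (X *m Y) = gr_lift X * gr_lift Y.
Proof. exact: map_mxM. Qed.

Lemma gr_lift1 : gr_lift 1 = 1. Proof. exact: map_mx1. Qed.

Lemma gr_liftX X k : gr_lift (X ^+ k) = gr_lift X ^+ k.
Proof. by elim: k => [|k IH]; rewrite ?gr_lift1 // !exprS gr_liftM IH. Qed.

Lemma gr_lift_sum n (F : 'I_n -> 'M[K]_m) : gr_lift (\sum_i F i) = \sum_i gr_lift (F i).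
Proof. exact: raddf_sum. Qed.

Lemma gr_lift_scalar_central (c : K) A :
  gr_lift c%:M * A = A * gr_lift c%:M.
Proof.
rewrite /gr_lift map_scalar_mx /=; apply/matrixP=> i j.
rewrite -!mulmxE mul_scalar_mx !mxE (bigD1 j) //= !mxE eqxx mulr1n.
rewrite big1 ?addr0 ?gr_scalarC // => l lj.
by rewrite !mxE (negbTE lj) mulr0.
Qed.

End MatrixGrading.

Section Gauge.
Variables (K : comNzRingType) (q m' : nat).
Local Notation m := m'.+1.
Local Notation G := (grassmann K q).
Variables (X V : 'M[K]_m).
Hypothesis HV : V *m horner_mx X (char_poly X)^`() = 1%:M.
Local Notation XG := (gr_lift q X).

Lemma horner_mx_sum (p : {poly K}) : 
  horner_mx X p = \sum_(k < size p) (p`_k)%:M * X ^+ k.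
Proof.
rewrite -{1}[p]coefK poly_def linear_sum /=; apply: eq_bigr => i _.
by rewrite linearZ rmorphXn /= horner_mx_X -mul_scalar_mx.
Qed.

Lemma horner_mx_deriv_sum (p : {poly K}) :
  horner_mx X p^`() = \sum_(k < size p) (p`_k)%:M * X ^+ k.-1 *+ k.
Proof.
rewrite -{1}[p]coefK poly_def raddf_sum linear_sum /=; apply: eq_bigr => i _.
by rewrite derivZ derivXn linearZ /= rmorphMn rmorphXn /= horner_mx_X -mul_scalar_mx mulmxE mulrnAr.
Qed.

Lemma gauge_split d N : mx_ge d N ->
  exists D r, [/\ mx_ge d D, mx_ge d r, XG * D = D * XG & D = N + (XG * r - r * XG)].
Proof.
move=> HN; pose p := char_poly X.
apply: (@ad_split _ XG (mx_ge d) _ _ _ _ (fun k => gr_lift q (p`_k)%:M) _ _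
  (size p) (gr_lift q V)) => //.
- exact: mx_ge0.
- exact: mx_geD.
- by move=> a; apply: mx_geMl.
- by move=> a; apply: mx_geMr.
- by move=> k a; apply: gr_lift_scalar_central.
- by move=> k a; apply: mx_geMl.
- under eq_bigr do rewrite -gr_liftX -gr_liftM.
  by rewrite -gr_lift_sum -horner_mx_sum Cayley_Hamilton; apply: raddf0.
- transitivity (gr_lift q (V *m horner_mx X p^`())); last by rewrite HV gr_lift1.
  rewrite horner_mx_deriv_sum gr_liftM; congr (_ * _).
  rewrite [RHS]gr_lift_sum; apply: eq_bigr => k _.
  by rewrite -gr_liftX -gr_liftM /gr_lift raddfMn.
- by move=> a; apply: mx_geMr.
Qed.

(** The additive content of the next conjugation, one letter per noncommutative monomial: u, v, w
    are rX, rC, rN; p is Xr; s, t are Cr, Dr; and D = N + Xr - rX. *)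
Let gauge_identity (T : zmodType) (x c n u v w p s t : T) :
  x + c + n - (u + v + w)
    = x + (c + (n + (p - u))) - (p + (s + t)) + (t - w) - (v - s).
Proof.
rewrite [in RHS](addrA c) 2!(addrA x); move: (x + c + n) => a.
rewrite opprB !opprD !addrA subrK [a + p - u]addrAC addrK.
by rewrite [a - u - s - w]addrAC subrK addrAC.
Qed.

(** Conjugation by [1 - r] replaces [N] by its commuting representative [D], up to an error of
    higher degree: D r and r N have degree at least 2d, and [r, C] at least d + 1 because [C] has
    degree at least 1. *)
Lemma gauge_step d C N : (0 < d)%N -> XG * C = C * XG -> mx_ge 1 C -> mx_ge d N ->
  exists g h C' N', [/\ g * h = 1, h * g = 1,
    g * (XG + C + N) = (XG + C' + N') * g &
    [/\ XG * C' = C' * XG, mx_ge 1 C' & mx_ge d.+1 N']].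
Proof.
move=> d0 XC C1 Nd; have [D [r [Dd rd XD defD]]] := gauge_split Nd.
have r1 : mx_ge 1 (- r) by apply: mx_geN; apply: mx_geW rd.
have [h [gh hg]] := mx_ge_unipotent r1.
pose E := (D * r - r * N - (r * C - C * r)).
(* The error is [E * h] because it has to stand to the left of the conjugating factor [1 - r], whose
   inverse is [h]. *)
exists (1 - r), h, (C + D), (E * h); split=> //.
  rewrite (mulrDl (XG + (C + D))) -mulrA hg mulr1 mulrBl mul1r mulrBr mulr1 /E.
  rewrite !(mulrDl, mulrDr) addrA {1}defD.
  exact: gauge_identity.
split.
- by rewrite mulrDr mulrDl XC XD.
- by apply: mx_geD => //; apply: mx_geW Dd.
- apply: mx_geMr; rewrite -(addn1 d).
  apply: mx_geD; last apply: mx_geN; apply: mx_geD; try apply: mx_geN.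
  + by apply: mx_geM => //; apply: mx_geW rd.
  + by apply: mx_geM => //; apply: mx_geW Nd.
  + by apply: mx_geM.
  + by rewrite addnC; apply: mx_geM.
Qed.

(** Each step raises the degree of the non-commuting remainder by one; after [q] steps it exceeds
    the number of odd coordinates and vanishes. *)
Lemma gauge N : mx_ge 1 N ->
  exists g h C, [/\ g * h = 1, h * g = 1, g * (XG + N) * h = XG + C,
    XG * C = C * XG & mx_ge 1 C].
Proof.
move=> N1.
have gauge_upto d : exists g h C N',
    [/\ g * h = 1, h * g = 1, g * (XG + N) = (XG + C + N') * g &
    [/\ XG * C = C * XG, mx_ge 1 C & mx_ge d.+1 N']].
  elim: d => [|d [g [h [C [N' [gh hg eN [XC C1 N'd]]]]]]].
    exists 1, 1, 0, N; rewrite !mulr1 mul1r addr0 mulr0 mul0r; split=> //.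
    by split=> //; apply: mx_ge0.
  have [g' [h' [C2 [N2 [gh' hg' eN' [XC2 C21 N2d]]]]]] := gauge_step (ltn0Sn d) XC C1 N'd.
  exists (g' * g), (h * h'), C2, N2; split=> //.
  - by rewrite mulrA -[g' * g * h]mulrA gh mulr1.
  - by rewrite mulrA -[h * h' * g']mulrA hg' mulr1.
  - by rewrite -mulrA eN mulrA eN' mulrA.
have [g [h [C [N' [gh hg eN [XC C1 N'q]]]]]] := gauge_upto q.
exists g, h, C; split=> //.
by rewrite eN (mx_ge_nil N'q) addr0 -mulrA gh mulr1.
Qed.


End Gauge.

(** * The recursion for the queer trace *)

Section EvenSubring.
Variables (K : comNzRingType) (q : nat).
Local Notation G := (grassmann K q).

Definition gr_evenb : {pred G} :=
  [pred f : G | [forall S : {set 'I_q}, odd #|S| ==> (f S == 0)]].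

Lemma gr_evenbP f : reflect (gr_par false f) (f \in gr_evenb).
Proof.
apply: (iffP forallP) => H S; first by rewrite eqbF_neg negbK => /(implyP (H S))/eqP.
by apply/implyP=> HS; rewrite H // HS.
Qed.

Lemma gr_evenb_subring : subring_closed gr_evenb.
Proof.
split=> [|f g /gr_evenbP Hf /gr_evenbP Hg|f g /gr_evenbP Hf /gr_evenbP Hg].
- by apply/gr_evenbP; apply: gr_par1.
- by apply/gr_evenbP; apply: gr_parD => //; apply: gr_parN.
- by apply/gr_evenbP; apply: (@gr_parM _ _ false false).
Qed.

HB.instance Definition _ := GRing.isSubringClosed.Build G gr_evenb gr_evenb_subring.

(** The even elements as a ring of their own: it is commutative, so even matrices have a
    characteristic polynomial and satisfy Cayley-Hamilton. *)
Record even_gr := EvenGr { even_val : G; _ : even_val \in gr_evenb }.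
HB.instance Definition _ := [isSub for even_val].
HB.instance Definition _ := [Choice of even_gr by <:].
HB.instance Definition _ := [SubChoice_isSubNzRing of even_gr by <:].

Lemma even_gr_mulC : commutative (@GRing.mul even_gr).
Proof.
move=> [f Hf] [g Hg]; apply: val_inj; rewrite !rmorphM /=.
by rewrite (gr_par_comm (gr_evenbP _ Hf) (gr_evenbP _ Hg)) scale1r.
Qed.

HB.instance Definition _ := GRing.PzRing_hasCommutativeMul.Build even_gr even_gr_mulC.

Lemma even_val_par (x : even_gr) : gr_par false (val x).
Proof. by case: x => f Hf; apply/gr_evenbP. Qed.

End EvenSubring.

Section Qtr.
Variables (K : comNzRingType) (q m : nat).
Local Notation G := (grassmann K q).
Implicit Types (A B : 'M[G]_m).

(** Only products of factors of opposite parity reach the odd part, and there one factor is even and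
    commutes with everything. Hence [qtr] is cyclic and invariant under conjugation. *)
Lemma gr_odd_mulC (f g : G) : gr_odd_part (f * g) = gr_odd_part (g * f).
Proof.
rewrite (gr_part_sum f) (gr_part_sum g) !gr_odd_partE.
have H b c : gr_part true (gr_part b f * gr_part c g) = gr_part true (gr_part c g * gr_part b f).
  have [Pf Pg] := (@gr_part_par _ _ b f, @gr_part_par _ _ c g).
  case: b c Pf Pg => [] [] Pf Pg; last 3 first.
  - by rewrite (gr_par_comm Pf Pg) scale1r.
  - by rewrite (gr_par_comm Pf Pg) scale1r.
  - by rewrite (gr_par_comm Pf Pg) scale1r.
  - by rewrite (gr_part_neq (gr_parM Pf Pg)) (gr_part_neq (gr_parM Pg Pf)).
by rewrite !mulrDl !mulrDr !raddfD /= !H addrACA.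
Qed.

Lemma qtr_is_zmod_morphism : zmod_morphism (@qtr K q m).
Proof.
move=> A B; rewrite /qtr -raddfB; congr (\tr _).
by apply/matrixP=> i j; rewrite !mxE raddfB.
Qed.

HB.instance Definition _ :=
  GRing.isZmodMorphism.Build 'M[G]_m G (@qtr K q m) qtr_is_zmod_morphism.

Lemma qtr_mulC A B : qtr (A * B) = qtr (B * A).
Proof.
rewrite /qtr /mxtrace.
under eq_bigr => i _ do rewrite !mxE raddf_sum /=.
rewrite exchange_big; apply: eq_bigr => i _; rewrite !mxE raddf_sum /=.
by apply: eq_bigr => j _; rewrite gr_odd_mulC.
Qed.

Lemma qtr_par_odd A : mx_par true A -> qtr A = \tr A.
Proof.
move=> HA; rewrite /qtr /mxtrace; apply: eq_bigr => i _.
by rewrite mxE gr_odd_partE gr_part_id.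
Qed.

Lemma qtr_par_even A : mx_par false A -> qtr A = 0.
Proof.
move=> HA; rewrite /qtr /mxtrace big1 // => i _.
by rewrite mxE gr_odd_partE (@gr_part_neq _ _ false).
Qed.

Lemma mx_parM b c A B : mx_par b A -> mx_par c B -> mx_par (b (+) c) (A * B).
Proof. by move=> HA HB i j; rewrite mxE; apply: gr_par_sum => l _; apply: gr_parM. Qed.

Lemma mx_par1 : mx_par false (1 : 'M[G]_m).
Proof.
move=> i j; rewrite mxE; case: (i == j); rewrite ?mulr1n; [exact: gr_par1 | exact: gr_par0].
Qed.

Lemma mx_par_evenX A k : mx_par false A -> mx_par false (A ^+ k).
Proof.
by move=> HA; elim: k => [|k IH]; [exact: mx_par1 | rewrite exprS; apply: (mx_parM HA IH)].
Qed.

End Qtr.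

Lemma exprD_nil2 (T : pzRingType) (P Z : T) k : P * Z = Z * P -> Z * Z = 0 ->
  (P + Z) ^+ k.+1 = P ^+ k.+1 + P ^+ k * Z *+ k.+1.
Proof.
move=> PZ ZZ; elim: k => [|k IH]; first by rewrite !expr1 mul1r.
rewrite exprS IH mulrDl !mulrDr -exprS mulrnAr mulrA -exprS mulrnAr !mulrA.
have ZP j : Z * P ^+ j = P ^+ j * Z by apply: commrX.
by rewrite !ZP -mulrA ZZ mulr0 mul0rn addr0 -addrA [in RHS]mulrSr.
Qed.

(** * Supercommutativity of the commutant of a matrix with a cyclic vector *)

Section Commutant.
Variables (K : comNzRingType) (q m' : nat).
Local Notation m := m'.+1.
Local Notation G := (grassmann K q).
Variables (X : 'M[K]_m) (v : 'rV[K]_m).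
Local Notation XG := (gr_lift q X).
(** The vector [v] is cyclic for [X] exactly when this determinant is a unit. Below it is only
    required to be a nonzerodivisor, as a fixed [v] need not be cyclic at every point of the open
    set. *)
Definition krylov : 'M[K]_m := \matrix_(i < m) (v *m X ^+ i).
Local Notation delta := (\det krylov).
Hypothesis delta_reg : forall x : K, delta * x = 0 -> x = 0.
Local Notation up := (map_mx (in_alg G)).

Let up_scale a b c (r : 'M[K]_(a, b)) (g : G) (A : 'M[G]_(b, c)) :
  up r *m (g *: A) = g *: (up r *m A).
Proof.
apply/matrixP=> i j; rewrite !mxE mulr_sumr; apply: eq_bigr => l _.
by rewrite !mxE mulrA gr_scalarC mulrA.
Qed.

Let scaleM (a b : G) i j :
  (a *: XG ^+ i) * (b *: XG ^+ j) = (a * b) *: XG ^+ (i + j).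
Proof.
rewrite -!gr_liftX -!mulmxE -scalemxAl up_scale scalerA; congr (_ *: _).
by rewrite exprD gr_liftM.
Qed.

Let mul_up_scalar (u : 'rV[G]_m) (x : K) : u *m up x%:M = (x%:A : G) *: u.
Proof.
apply/matrixP=> i j; rewrite !mxE (bigD1 j) //= !mxE eqxx mulr1n big1 ?addr0.
  by rewrite gr_scalarC.
by move=> l lj; rewrite !mxE (negbTE lj) mulr0n rmorph0 mulr0.
Qed.

Let delta_cancel (A : 'M[G]_m) : (delta%:A : G) *: A = 0 -> A = 0.
Proof.
move=> A0; apply/matrixP=> i j; apply/ffunP=> S.
move/matrixP/(_ i j)/ffunP/(_ S): A0.
rewrite !mxE -scalerAl mul1r gr_scaleE => A0.
by rewrite [RHS]gr_0E; apply: delta_reg; rewrite A0; apply: gr_0E.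
Qed.

(** By Cramer's rule delta v U is a combination of the v X^j, with coefficients of the parity of
    [U]. An element of the commutant is determined by its value on the cyclic vector, so the same
    combination of the X^j gives delta U. *)
Lemma commutant_poly b U : XG * U = U * XG -> mx_par b U ->
  exists c : 'I_m -> G, (forall j, gr_par b (c j)) /\
    (delta%:A : G) *: U = \sum_j c j *: XG ^+ j.
Proof.
move=> XU HU; pose w := up v *m U; pose c : 'rV[G]_m := w *m up (\adj krylov).
have cw : c *m up krylov = (delta%:A : G) *: w.
  by rewrite /c -mulmxA -map_mxM mul_adj_mx; apply: mul_up_scalar.
exists (fun j => c 0 j); split=> [j|].
  rewrite mxE; apply: gr_par_sum => l _; rewrite -[b]addbF; apply: gr_parM.
    by rewrite mxE; apply: gr_par_sum => k _; apply: (@gr_parM _ _ false b) => //;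
      rewrite mxE; apply/gr_parZ/gr_par1.
  by rewrite mxE; apply/gr_parZ/gr_par1.
apply/eqP; rewrite -subr_eq0; apply/eqP; apply: delta_cancel.
set D := _ - _.
(* [U] and all X^j commute with X^i, so the identity for v X^i follows from the one for [v]. The
   adjugate then turns this into delta D = 0. *)
have KD : up krylov *m D = 0.
  apply/row_matrixP=> i; rewrite row0 row_mul -map_row rowK map_mxM.
  rewrite -map_mxM mulmxBr up_scale mulmx_sumr map_mxM; apply/eqP; rewrite subr_eq0; apply/eqP.
  have upX k : up (X ^+ k) = XG ^+ k by rewrite -gr_liftX.
  rewrite upX.
  have -> : up v *m XG ^+ i *m U = w *m XG ^+ i.
    by rewrite -!mulmxA !mulmxE (commrX i (esym XU)).
  rewrite scalemxAl -cw (mulmx_sum_row c) mulmx_suml; apply: eq_bigr => j _.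
  rewrite -map_row rowK map_mxM upX.
  have -> : up v *m XG ^+ i = up (v *m X ^+ i) by rewrite map_mxM upX.
  rewrite up_scale map_mxM upX -scalemxAl -!mulmxA; congr (_ *: (_ *m _)).
  by rewrite !mulmxE -!exprD addnC.
transitivity (up (\adj krylov *m krylov) *m D); last by rewrite map_mxM -mulmxA KD mulmx0.
by rewrite mul_adj_mx map_scalar_mx mul_scalar_mx.
Qed.

(** After multiplication by delta both factors are polynomials in [X] with homogeneous coefficients,
    and only these coefficients produce a sign. The factor delta is cancelled twice. *)
Lemma commutant_supercomm b b' U U' :
    XG * U = U * XG -> XG * U' = U' * XG -> mx_par b U -> mx_par b' U' ->
  U * U' = (-1) ^+ (b && b') * (U' * U).
Proof.
move=> XU XU' HU HU'.
have [c [cb defU]] := commutant_poly XU HU.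
have [c' [cb' defU']] := commutant_poly XU' HU'.
pose d := delta%:A : G.
have dd (A B : 'M[G]_m) : d *: (d *: (A * B)) = (d *: A) * (d *: B).
  rewrite -!mulmxE -scalemxAl; congr (_ *: _).
  by apply/matrixP=> i j; rewrite !mxE mulr_sumr; apply: eq_bigr => l _; rewrite !mxE !mulrA gr_scalarC.
apply/eqP; rewrite -subr_eq0; apply/eqP; do 2 apply: delta_cancel.
rewrite -/d scalerBr scalerBr dd defU defU'.
have -> : d *: (d *: ((-1) ^+ (b && b') * (U' * U))) =
    (-1) ^+ (b && b') * ((d *: U') * (d *: U)).
  by rewrite -dd; case: (b && b'); rewrite ?mul1r ?mulN1r ?scalerN.
rewrite defU defU' !mulr_suml.
under [X in X - _]eq_bigr => i _ do rewrite mulr_sumr.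
rewrite exchange_big /= mulr_sumr -sumrB big1 // => j _.
rewrite !mulr_sumr -sumrB big1 // => i _.
rewrite !scaleM (gr_par_comm (cb i) (cb' j)) addnC.
by case: (b && b'); rewrite ?scale1r ?mul1r ?mulN1r ?scaleN1r ?scaleNr subrr.
Qed.

End Commutant.

Section QtrRecursion.
Variables (K : comNzRingType) (q m' : nat).
Local Notation m := m'.+1.
Local Notation G := (grassmann K q).
Variables (X V : 'M[K]_m) (v : 'rV[K]_m).
Hypothesis HV : V *m horner_mx X (char_poly X)^`() = 1%:M.
Hypothesis krylov_reg : forall x : K, \det (krylov X v) * x = 0 -> x = 0.
Hypothesis two_reg : forall x : K, x *+ 2 = 0 -> x = 0.
Local Notation XG := (gr_lift q X).

(** The entries of [XG] are even scalars, so the relation holds in each parity separately. *)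
Lemma gr_part_commute b (B : 'M[G]_m) : XG * B = B * XG ->
  XG * map_mx (gr_part b) B = map_mx (gr_part b) B * XG.
Proof.
have partZ c (f : G) : gr_part b (c *: f) = c *: gr_part b f.
  by apply/ffunP=> S; rewrite gr_scaleE !gr_partE gr_scaleE; case: ifP; rewrite ?mulr0.
move=> XB; apply/matrixP=> i j; move/matrixP/(_ i j): XB; rewrite !mxE.
move/(congr1 (gr_part b)); rewrite !raddf_sum /= => H.
transitivity (\sum_l gr_part b (XG i l * B l j)); last rewrite H;
  apply: eq_bigr => l _; rewrite !mxE ?gr_scalarC -?gr_scalarC -!scalerAl;
  by rewrite ?mul1r -?scalerAr ?mulr1 partZ.
Qed.

Lemma even_mx_charpoly (Y : 'M[G]_m) : mx_par false Y ->
  exists p : nat -> G, (forall j, gr_par false (p j)) /\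
    Y ^+ m = - \sum_(k < m) p k *: Y ^+ k.
Proof.
move=> HY; pose Y' : 'M[even_gr K q]_m := \matrix_(i, j) insubd 0 (Y i j).
have YE : map_mx val Y' = Y.
  by apply/matrixP=> i j; rewrite !mxE insubdK //; apply/gr_evenbP.
pose p := char_poly Y'; exists (fun j => val p`_j); split=> [j|]; first exact: even_val_par.
have := Cayley_Hamilton Y'; rewrite horner_mx_sum size_char_poly big_ord_recr /=.
have -> : (char_poly Y')`_m = 1.
  by have /monicP := char_poly_monic Y'; rewrite /lead_coef size_char_poly.
rewrite mul1r => /(congr1 (map_mx val)); rewrite map_mx0 map_mxD => H.
have YX k : map_mx val (Y' ^+ k) = Y ^+ k.
  by elim: k => [|k IH]; rewrite ?map_mx1 // !exprS map_mxM IH YE.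
apply/eqP; rewrite -addr_eq0 -YX addrC -[X in _ == X]H; apply/eqP; congr (_ + _).
rewrite raddf_sum; apply: eq_bigr => k _.
by rewrite -[RHS]/(map_mx val _) map_mxM map_scalar_mx YX mul_scalar_mx.
Qed.

Theorem qtr_recursion (N : 'M[G]_m) : mx_par true N ->
  exists s t : nat -> G, [/\ forall j, gr_par false (s j),
    forall k, qtr ((XG + N) ^+ k.+1) = t k.+1 *+ k.+1
  & forall k, t (k + m + 1)%N =
      \sum_(1 <= i < m.+1) t (k + i)%N * s (m - i + 1)%N].
Proof.
move=> HN; have [g [h [C [gh hg gNh XC C1]]]] := gauge HV (mx_par_ge1 HN).
pose B := XG + C; pose Y := map_mx (gr_part false) B; pose Z := map_mx (gr_part true) B.
have XB : XG * B = B * XG by rewrite mulrDr mulrDl XC.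
have BE : B = Y + Z by apply/matrixP=> i j; rewrite !mxE -gr_part_sum.
have XY : XG * Y = Y * XG by apply: gr_part_commute.
have XZ : XG * Z = Z * XG by apply: gr_part_commute.
have HY : mx_par false Y by move=> i j; rewrite mxE; apply: gr_part_par.
have HZ : mx_par true Z by move=> i j; rewrite mxE; apply: gr_part_par.
have YZ : Y * Z = Z * Y.
  by rewrite (commutant_supercomm krylov_reg XY XZ HY HZ) mul1r.
(* Supercommutation of the odd [Z] with itself reads Z Z = - Z Z, and 2 can be cancelled. *)
have ZZ : Z * Z = 0.
  have := commutant_supercomm krylov_reg XZ XZ HZ HZ; rewrite mulN1r => /eqP.
  rewrite -addr_eq0 => /eqP; move: (Z * Z) => W Z0; apply/matrixP=> i j; apply/ffunP=> S.
  move/matrixP/(_ i j)/ffunP/(_ S): Z0.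
  by rewrite !mxE gr_addE -mulr2n !gr_0E => /two_reg.
have [p [Hp pY]] := even_mx_charpoly HY.
have powB k : (g * (XG + N) * h) ^+ k = g * (XG + N) ^+ k * h.
  elim: k => [|k IH]; first by rewrite mulr1 gh.
  by rewrite !exprS IH !mulrA -[_ * h * g]mulrA hg mulr1.
(* In (Y + Z)^k = Y^k + k Y^(k-1) Z the first term is even and has no queer trace. The truncated
   predecessor at 0 is harmless, as only indices from 1 on occur. *)
pose t k := \tr (Y ^+ k.-1 * Z).
have HYZ k : mx_par true (Y ^+ k * Z) by apply: (mx_parM (mx_par_evenX k HY) HZ).
(* The coefficient next to t(k+i) must be -p_(i-1), and i - 1 = m - (m - i + 1). *)
exists (fun j => - p (m - j)%N), t; split=> [j|k|k].
- exact: gr_parN.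
- have -> : qtr ((XG + N) ^+ k.+1) = qtr (B ^+ k.+1).
    by rewrite /B -gNh powB qtr_mulC mulrA hg mul1r.
  rewrite BE exprD_nil2 // raddfD raddfMn /= qtr_par_even ?add0r; last exact: mx_par_evenX.
  by rewrite qtr_par_odd.
- rewrite /t addn1 /= exprD pY mulrN mulNr (raddfN (@mxtrace G m)) mulr_sumr mulr_suml.
  rewrite (raddf_sum (@mxtrace G m)) /=.
  rewrite big_add1 big_mkord -sumrN; apply: eq_bigr => i _ /=.
  rewrite addnS /= mulrN; congr (- _).
  have -> : (m - (m - i.+1 + 1) = i)%N by rewrite addn1 subnSK ?ltn_ord // subKn // ltnW.
  have -> : Y ^+ k * (p i *: Y ^+ i) = p i *: Y ^+ (k + i).
    apply/matrixP=> a b; rewrite exprD !mxE mulr_sumr; apply: eq_bigr => l _.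
    by rewrite !mxE mulrA (gr_par_comm (mx_par_evenX k HY a l) (Hp i)) scale1r mulrA.
  rewrite -mulmxE -scalemxAl mxtraceZ.
  have HT : gr_par true (\tr (Y ^+ (k + i) * Z)).
    by apply: gr_par_sum => l _; apply: HYZ.
  by rewrite (gr_par_comm (Hp i) HT) scale1r.
Qed.

End QtrRecursion.

(** * Rational solutions *)

Section Specialization.
Variables (R1 R2 : comNzRingType) (phi : {rmorphism R1 -> R2}) (q : nat).
Local Notation G1 := (grassmann R1 q).
Local Notation G2 := (grassmann R2 q).
Variable T : {set 'I_q}.

(** Change of coefficients along [phi], combined with setting the odd coordinates outside [T] to
    zero; it is a ring morphism since [S] lies in [T] exactly when both parts of a splitting of [S]
    do. *)
Definition gr_spec (f : G1) : G2 :=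
  [ffun S : {set 'I_q} => if S \subset T then phi (f S) else 0].

Lemma gr_specE f S : gr_spec f S = if S \subset T then phi (f S) else 0.
Proof. exact: ffunE. Qed.

Lemma gr_spec_is_zmod_morphism : zmod_morphism gr_spec.
Proof.
move=> f g; apply/ffunP=> S; rewrite gr_addE gr_oppE !gr_specE gr_addE gr_oppE.
by case: ifP => _; rewrite ?subr0 // rmorphB.
Qed.

Lemma gr_spec_is_monoid_morphism : monoid_morphism gr_spec.
Proof.
split=> [|f g]; apply/ffunP=> S.
  rewrite gr_1E gr_specE gr_1E; have [->|_] := eqVneq S set0.
    by rewrite sub0set rmorph1.
  by case: ifP; rewrite ?rmorph0.
rewrite gr_mulE gr_specE gr_mulE; case: (boolP (S \subset T)) => ST.
  rewrite rmorph_sum; apply: eq_bigr => A AS.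
  rewrite !gr_specE (subset_trans AS ST) (subset_trans (subsetDl S A) ST).
  by rewrite !rmorphM rmorph_sign.
rewrite big1 // => A AS; rewrite !gr_specE.
case: (boolP (A \subset T)) => AT; last by rewrite mul0r mulr0.
case: (boolP (S :\: A \subset T)) => BT; last by rewrite !mulr0.
by case/negP: ST; rewrite -(setU_setD AS) subUset AT.
Qed.

HB.instance Definition _ :=
  GRing.isZmodMorphism.Build G1 G2 gr_spec gr_spec_is_zmod_morphism.
HB.instance Definition _ :=
  GRing.isMonoidMorphism.Build G1 G2 gr_spec gr_spec_is_monoid_morphism.

Lemma gr_specZ c f : gr_spec (c *: f) = phi c *: gr_spec f.
Proof.
apply/ffunP=> S; rewrite gr_scaleE !gr_specE gr_scaleE.
by case: ifP; rewrite ?mulr0 // rmorphM.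
Qed.

Lemma gr_spec_gen i :
  gr_spec (gr_gen R1 i) = if i \in T then gr_gen R2 i else 0.
Proof.
apply/ffunP=> S; rewrite gr_specE gr_genE.
have [->|nS] := eqVneq S [set i].
  by rewrite sub1set; case: ifP; rewrite ?gr_genE ?eqxx ?rmorph1 ?gr_0E.
by rewrite rmorph0; case: (i \in T); rewrite ?gr_genE ?(negbTE nS) ?gr_0E if_same.
Qed.

Lemma gr_spec_odd_part f : gr_spec (gr_odd_part f) = gr_odd_part (gr_spec f).
Proof.
apply/ffunP=> S; rewrite gr_specE !gr_odd_partE !gr_partE gr_specE.
by case: ifP; case: ifP; rewrite ?rmorph0.
Qed.

Lemma gr_spec_par b f : gr_par b f -> gr_par b (gr_spec f).
Proof. by move=> Hf S HS; rewrite gr_specE Hf // rmorph0 if_same. Qed.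

Lemma gr_spec_qtr m (A : 'M[G1]_m) : gr_spec (qtr A) = qtr (map_mx gr_spec A).
Proof.
rewrite /qtr /mxtrace raddf_sum; apply: eq_bigr => i _.
by rewrite !mxE; apply: gr_spec_odd_part.
Qed.

Lemma gr_spec_lift m (X : 'M[R1]_m) :
  map_mx gr_spec (gr_lift q X) = gr_lift q (map_mx phi X).
Proof. by apply/matrixP=> i j; rewrite !mxE gr_specZ rmorph1. Qed.

Lemma map_gr_specX m (A : 'M[G1]_m) k :
  map_mx gr_spec (A ^+ k) = map_mx gr_spec A ^+ k.
Proof. by elim: k => [|k IH]; rewrite ?map_mx1 // !exprS map_mxM IH. Qed.

End Specialization.

Section DiscriminantMorphism.
Variables (R1 R2 : comNzRingType) (phi : {rmorphism R1 -> R2}) (m' : nat).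
Variable (X : 'M[R1]_m'.+1).

(** Up to sign this is the discriminant of the characteristic polynomial p, being the product of the
    p'(a) over its roots a. *)
Definition char_poly_disc (R : comNzRingType) (Y : 'M[R]_m'.+1) :=
  \det (horner_mx Y (char_poly Y)^`()).

Lemma char_poly_disc_map : phi (char_poly_disc X) = char_poly_disc (map_mx phi X).
Proof. by rewrite /char_poly_disc -det_map_mx map_horner_mx -deriv_map map_char_poly. Qed.

Lemma krylov_map v :
  phi (\det (krylov X v)) = \det (krylov (map_mx phi X) (map_mx phi v)).
Proof.
rewrite -det_map_mx; congr (\det _); apply/row_matrixP=> i.
rewrite -map_row !rowK map_mxM; congr (_ *m _).
by elim: (i : nat) => [|k IH]; rewrite ?map_mx1 // !exprS map_mxM IH.
Qed.

End DiscriminantMorphism.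

(** * The ring of functions regular on the open set *)

Lemma fraction_sub (F : fieldType) (x y z w : F) :
  y != 0 -> w != 0 -> x / y - z / w = (x * w - z * y) / (y * w).
Proof. by move=> y0 w0; rewrite -mulNr addf_div // mulNr. Qed.

Section RegularFunctions.
Variables (F : fieldType) (p : nat) (U : 'rV[F]_p -> Prop).
Local Notation R := {mpoly F[p]}.
Local Notation K := {fraction {mpoly F[p]}}.

Lemma tofrac_neq0 (f : R) x : f.@[x] != 0 -> (tofrac f : K) != 0.
Proof. by rewrite tofrac_eq0; apply: contraNneq => ->; rewrite meval0. Qed.

Definition regular_on : {pred K} :=
  [pred phi | `[< forall x, U x -> regular_at phi x >]].

Lemma regular_onP phi :
  reflect (forall x, U x -> regular_at phi x) (phi \in regular_on).
Proof. exact: asboolP. Qed.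

Lemma regular_on_subring : subring_closed regular_on.
Proof.
split=> [|f g /regular_onP Hf /regular_onP Hg|f g /regular_onP Hf /regular_onP Hg];
    apply/regular_onP => x Ux.
- by exists 1, 1; rewrite meval1 oner_neq0 divr1 rmorph1.
- have [[a [b [b0 ->]]] [c [d [d0 ->]]]] := (Hf x Ux, Hg x Ux).
  exists (a * d - c * b), (b * d); rewrite mevalM mulf_neq0 //; split=> //.
  have [B D] := (tofrac_neq0 b0, tofrac_neq0 d0).
  rewrite (rmorphB (@tofrac R)) !(rmorphM (@tofrac R)).
  exact: fraction_sub B D.
- have [[a [b [b0 ->]]] [c [d [d0 ->]]]] := (Hf x Ux, Hg x Ux).
  exists (a * c), (b * d); rewrite mevalM mulf_neq0 //; split=> //.
  by rewrite !(rmorphM (@tofrac R)) mulf_div.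
Qed.

HB.instance Definition _ := GRing.isSubringClosed.Build K regular_on regular_on_subring.

(** Running the recursion over this ring instead of the whole function field makes the solutions
    free of singular points by construction. *)
Record regular_fun := RegularFun { regular_val : K; _ : regular_val \in regular_on }.
HB.instance Definition _ := [isSub for regular_val].
HB.instance Definition _ := [Choice of regular_fun by <:].
HB.instance Definition _ := [SubChoice_isSubComNzRing of regular_fun by <:].

Lemma polynomial_regular (f : R) : tofrac f \in regular_on.
Proof. by apply/regular_onP=> x _; exists f, 1; rewrite meval1 oner_neq0 rmorph1 divr1. Qed.

Definition regular_of_poly (f : R) : regular_fun := RegularFun (polynomial_regular f).

Lemma inverse_regular (f : R) : (forall x, U x -> f.@[x 0] != 0) ->
  (tofrac f)^-1 \in regular_on.
Proof.
by move=> H; apply/regular_onP=> x Ux; exists 1, f; rewrite H // rmorph1 div1r.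
Qed.

End RegularFunctions.

Section RationalRecursion.
Variables (F : fieldType) (p q m' : nat) (U : 'rV[F]_p -> Prop).
Local Notation m := m'.+1.
Local Notation R := {mpoly F[p]}.
Local Notation K := {fraction {mpoly F[p]}}.
Local Notation O := (regular_fun U).
Hypothesis two_neq0 : 2%:R != 0 :> F.

Definition ratfun_const : F -> K := @tofrac R \o @mpolyC p F.
HB.instance Definition _ := GRing.RMorphism.on ratfun_const.

(** The two genericity conditions differ in strength. The discriminant is inverted, so it must not
    vanish anywhere on [U]. The Krylov determinant is only cancelled in an integral domain, so one
    point [y], inside [U] or not, suffices. *)
Theorem ratfun_qtr_recursion (X : 'M[R]_m) (N : 'M[grassmann F q]_m)
    (v : 'rV[F]_m) (y : 'I_p -> F) :
    (exists x, U x) -> mx_par true N ->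
    (forall x, U x -> char_poly_disc (map_mx (meval (x 0)) X) != 0) ->
    \det (krylov (map_mx (meval y) X) v) != 0 ->
  exists s t : nat -> ratfun F p q, [/\ forall j, gr_even (s j),
    forall j, no_singular_points U (s j),
    forall k, qtr ((gr_lift q (map_mx (@tofrac _) X)
                    + map_mx (gr_spec ratfun_const setT) N) ^+ k.+1) = t k.+1 *+ k.+1
  & forall k, t (k + m + 1)%N =
      \sum_(1 <= i < m.+1) t (k + i)%N * s (m - i + 1)%N].
Proof.
move=> [x0 Ux0] HN HD Hv.
pose XO : 'M[O]_m := map_mx (@regular_of_poly _ _ U) X.
pose valO : {rmorphism O -> K} := val.
have valX : map_mx valO XO = map_mx (@tofrac _) X by apply/matrixP=> i j; rewrite !mxE.
pose NO : 'M[grassmann O q]_m := map_mx (fun f : grassmann F q =>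
  [ffun S : {set 'I_q} => regular_of_poly U (f S)%:MP] : grassmann O q) N.
have HNO : mx_par true NO.
  move=> i j S HS; rewrite mxE ffunE HN //; apply: val_inj.
  by rewrite [RHS](rmorph0 valO) /= mpolyC0 rmorph0.
have valN : map_mx (gr_spec valO setT) NO = map_mx (gr_spec ratfun_const setT) N.
  by apply/matrixP=> i j; rewrite !mxE; apply/ffunP=> S; rewrite !gr_specE ffunE.
pose D := char_poly_disc X.
have HDx x : U x -> D.@[x 0] != 0 by move=> Ux; rewrite /D char_poly_disc_map HD.
have D0 := tofrac_neq0 (HDx _ Ux0).
pose iD : O := RegularFun (inverse_regular HDx).
(* The inverse of p'(X) by Cramer's rule; the reciprocal of its determinant is regular on [U]. *)
pose V := iD *: \adj (horner_mx XO (char_poly XO)^`()).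
have HV : V *m horner_mx XO (char_poly XO)^`() = 1%:M.
  rewrite -scalemxAl mul_adj_mx scale_scalar_mx; congr _%:M; apply: val_inj.
  rewrite rmorphM -[X in _ * X]/(valO (char_poly_disc XO)) char_poly_disc_map valX.
  by rewrite -char_poly_disc_map /= mulVf // rmorph1.
pose vO : 'rV[O]_m := map_mx (fun c => regular_of_poly U c%:MP) v.
have val0 (x : O) : valO x = 0 -> x = 0.
  by move=> Hx; apply: val_inj; rewrite [LHS]Hx [RHS](rmorph0 valO).
(* The Krylov determinant is a polynomial with a nonzero value at [y], hence nonzero in the function
   field. *)
have kry_reg (x : O) : \det (krylov XO vO) * x = 0 -> x = 0.
  move/(congr1 valO)/eqP; rewrite rmorph0 rmorphM mulf_eq0 => /orP[|/eqP/val0//].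
  have -> : valO (\det (krylov XO vO)) = tofrac (\det (krylov X (map_mx (@mpolyC p F) v))).
    rewrite !krylov_map valX; congr (\det (krylov _ _)).
    by apply/matrixP=> i j; rewrite !mxE.
  rewrite tofrac_eq0 => /eqP /(congr1 (meval y)); rewrite krylov_map meval0.
  have -> : map_mx (meval y) (map_mx (@mpolyC p F) v) = v.
    by apply/matrixP=> i j; rewrite !mxE mevalC.
  by move/eqP; rewrite (negbTE Hv).
have two_reg (x : O) : x *+ 2 = 0 -> x = 0.
  move/(congr1 valO)/eqP; rewrite rmorph0 rmorphMn /= -mulr_natr mulf_eq0.
  case/orP=> [/eqP/val0//|].
  rewrite -(rmorph_nat (ratfun_const : {rmorphism F -> K})) fmorph_eq0.
  by rewrite (negbTE two_neq0).
have [s [t [sE qt ts]]] := qtr_recursion HV kry_reg two_reg HNO.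
pose up : grassmann O q -> ratfun F p q := gr_spec valO setT.
exists (up \o s), (up \o t); split=> [j|j S x Ux|k|k].
- by apply/gr_even_par; apply: gr_spec_par.
- rewrite /= gr_specE subsetT; apply: (regular_onP U _ _ x Ux).
  exact: valP.
- transitivity (up (qtr ((gr_lift q XO + NO) ^+ k.+1))); last by rewrite qt /up raddfMn.
  by rewrite /up gr_spec_qtr map_gr_specX map_mxD gr_spec_lift valX valN.
- rewrite /= /up ts rmorph_sum; apply: eq_bigr => i _; exact: rmorphM.
Qed.
End RationalRecursion.

(** * Genericity conditions, and existence for Q(n) *)

(** The characteristic polynomial p splits into distinct linear factors, so it is coprime to p'. A
    Bezout relation evaluated at [M] loses its p-term by Cayley-Hamilton and exhibits an inverse of
    p'(M). *)
Lemma distinct_eigenvalues_disc (F : fieldType) m' (M : 'M[F]_m'.+1) (e : seq F) :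
  uniq e -> size e = m'.+1 -> all (eigenvalue M) e -> char_poly_disc M != 0.
Proof.
move=> ue se /allP ev; set p := char_poly M.
have pE : p = \prod_(a <- e) ('X - a%:P).
  rewrite [LHS](all_roots_prod_XsubC (rs := e)) ?uniq_rootsE //.
  - by have /monicP -> := char_poly_monic M; rewrite scale1r.
  - by rewrite size_char_poly se.
  - by apply/allP=> a /ev; rewrite eigenvalue_root_char.
have : separable_poly p by rewrite pE separable_prod_XsubC.
rewrite separable_poly.unlock => /Bezout_eq1_coprimepP[[u w]] /= /(congr1 (horner_mx M)).
rewrite rmorphD !rmorphM /= Cayley_Hamilton mulr0 add0r rmorph1 => H.
apply: contra_eq_neq (congr1 determinant H) => D0.
by rewrite det_mulmx [X in _ * X]D0 mulr0 det1 eq_sym oner_eq0.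
Qed.

(** [f] lists the basis in the order in which [M] shifts it. The Krylov matrix is then a permutation
    matrix, inverted by its transpose. *)
Lemma krylov_shift (F : fieldType) m' (M : 'M[F]_m'.+1) (f : nat -> 'I_m'.+1) :
  (forall i j, (i < m'.+1)%N -> (j < m'.+1)%N -> f i = f j -> i = j) ->
  (forall i, (i.+1 < m'.+1)%N -> row (f i) M = delta_mx 0 (f i.+1)) ->
  \det (krylov M (delta_mx 0 (f 0%N))) != 0.
Proof.
move=> fI fM.
have KE i : (i < m'.+1)%N -> delta_mx 0 (f 0%N) *m M ^+ i = delta_mx 0 (f i) :> 'rV_m'.+1.
  elim: i => [|i IH] Hi; first by rewrite mulmx1.
  by rewrite exprSr mulmxA IH 1?ltnW // -rowE fM.
have KrE (i l : 'I_m'.+1) : krylov M (delta_mx 0 (f 0%N)) i l = (l == f i)%:R.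
  have /rowP/(_ l) : row i (krylov M (delta_mx 0 (f 0%N))) = delta_mx 0 (f i).
    by rewrite rowK KE.
  by rewrite !mxE eqxx.
have KK : krylov M (delta_mx 0 (f 0%N)) *m (krylov M (delta_mx 0 (f 0%N)))^T = 1%:M.
  apply/matrixP=> i j; rewrite mxE (bigD1 (f i)) //= big1 ?addr0 => [|l lf].
    rewrite KrE eqxx mul1r mxE KrE mxE; congr (nat_of_bool _)%:R.
    by apply/eqP/eqP=> [/(fI _ _ (ltn_ord i) (ltn_ord j))/ord_inj//|->].
  by rewrite KrE (negbTE lf) mul0r.
apply: contra_eq_neq (congr1 determinant KK) => D0.
by rewrite det_mulmx D0 mul0r det1 eq_sym oner_eq0.
Qed.

Section Existence.
Variable (C : numClosedFieldType).

Let two_neq0 : 2%:R != 0 :> C. Proof. by rewrite pnatr_eq0. Qed.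

Lemma ratfun_natr_neq0 p k : k.+1%:R != 0 :> {fraction {mpoly C[p]}}.
Proof. by rewrite -(rmorph_nat (@ratfun_const C p : {rmorphism _ -> _})) fmorph_eq0 pnatr_eq0. Qed.

Lemma scale_natr_inv p q (t : ratfun C p q) k : k.+1%:R^-1 *: (t *+ k.+1) = t.
Proof. by rewrite -scaler_nat scalerA mulVf ?ratfun_natr_neq0 // scale1r. Qed.

Lemma Q_existence n' (n := n'.+1) : exists s : nat -> ratfun C (n * n) (n * n),
  (forall j, gr_even (s j) /\ no_singular_points (@Q_tilde C n) (s j)) /\
  (forall k, Q_tau C n (k + n + 1) =
     \sum_(1 <= i < n.+1) Q_tau C n (k + i) * s (n - i + 1)%N).
Proof.
pose X : 'M[{mpoly C[n * n]}]_n := \matrix_(i, j) 'X_(mxvec_index i j).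
pose N : 'M[grassmann C (n * n)]_n := \matrix_(i, j) gr_gen C (mxvec_index i j).
have XE (x : 'rV[C]_(n * n)) : map_mx (meval (x 0)) X = vec_mx x.
  by apply/matrixP=> i j; rewrite !mxE mevalXU.
have AE : Q_matrix C n = gr_lift (n * n) (map_mx (@tofrac _) X)
           + map_mx (gr_spec (@ratfun_const C (n * n)) setT) N.
  by apply/matrixP=> i j; rewrite !mxE gr_spec_gen inE.
(* The nilpotent shift, with the first basis vector as cyclic vector. It serves as the point [y];
   for n > 1 it has a multiple eigenvalue and lies outside the open set. *)
pose sh : 'M[C]_n := \matrix_(i, j) (j == i.+1 :> nat)%:R.
have [||||s [t [sE sR qt ts]]] := @ratfun_qtr_recursion C (n * n) (n * n) n' (@Q_tilde C n)
    two_neq0 X N (delta_mx 0 (inord 0)) (mxvec sh 0).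
(* The diagonal matrix with entries 0, ..., n-1 shows that the open set has a point. *)
- pose e := [tuple (i : nat)%:R : C | i < n].
  exists (mxvec (diag_mx (\row_i (i : nat)%:R))), e.
  rewrite mxvecK map_inj_uniq ?enum_uniq; last first.
    by move=> i j /eqP; rewrite eqr_nat => /eqP /ord_inj.
  split=> //; apply/allP=> a /mapP[i _ ->]; apply/eigenvalueP.
  exists (delta_mx 0 i); last first.
    by apply/eqP=> /matrixP/(_ 0 i); rewrite !mxE !eqxx => /eqP; rewrite oner_eq0.
  rewrite -rowE; apply/matrixP=> a' j; rewrite !mxE [a']ord1 eqxx /=.
  by have [->|ij] := eqVneq i j; rewrite ?mulr1 ?mulr0.
- by move=> i j; rewrite mxE; apply: gr_par_gen.
- move=> x [e [ue ev]]; rewrite XE.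
  by apply: (distinct_eigenvalues_disc ue) ev; rewrite size_tuple.
- rewrite XE mxvecK; apply: (krylov_shift (f := inord)) => [i j Hi Hj|i Hi].
    by move/(congr1 val) => /=; rewrite !inordK.
  apply/matrixP=> a j; rewrite !mxE [a]ord1 eqxx /= inordK 1?ltnW //.
  by rewrite -val_eqE /= inordK.
have tauE k : Q_tau C n k.+1 = t k.+1 by rewrite /Q_tau AE qt scale_natr_inv.
exists s; split=> [j|k]; first by split.
rewrite addn1 tauE -addn1 ts; apply: eq_big_nat => i /andP[i1 _].
by rewrite -(prednK i1) addnS tauE.
Qed.

End Existence.

(** * Existence for Odd(n) by reduction to Q(2n) *)

Section SuperParity.
Variables (K : comNzRingType) (q n : nat).
Local Notation G := (grassmann K q).
Implicit Types A B : 'M[G]_(n + n).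

(** Parity in the supermatrix sense: diagonal blocks have parity [c], off-diagonal blocks the
    opposite one. For an odd supermatrix, odd powers have odd diagonal entries, so [qtr] is the
    supertrace, and even powers have even ones, so [qtr] vanishes. *)
Definition super_par (c : bool) A :=
  forall i j : 'I_(n + n), gr_par ((n <= i)%N (+) (n <= j)%N (+) c) (A i j).

Lemma super_parM b c A B : super_par b A -> super_par c B -> super_par (b (+) c) (A * B).
Proof.
move=> HA HB i j; rewrite mxE; apply: gr_par_sum => l _.
have := gr_parM (HA i l) (HB l j).
by case: (n <= i)%N (n <= j)%N (n <= l)%N b c {HA HB} => [] [] [] [] [].
Qed.

Lemma super_parX A k : super_par true A -> super_par (odd k) (A ^+ k).
Proof.
move=> HA; elim: k => [|k IH].
  move=> i j; rewrite mxE; have [->|_] := eqVneq i j; last exact: gr_par0.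
  by rewrite addbb; apply: gr_par1.
by rewrite exprS; apply: (super_parM HA IH).
Qed.

Lemma odd_str_trace A : odd_str A = \tr A.
Proof. by rewrite -[in RHS](submxK A) mxtrace_block. Qed.

Lemma super_par_odd_qtr A k : super_par true A -> odd k -> qtr (A ^+ k) = odd_str (A ^+ k).
Proof.
move=> HA ok; rewrite odd_str_trace /qtr /mxtrace; apply: eq_bigr => i _.
rewrite mxE gr_odd_partE gr_part_id //.
by have /(_ i i) := @super_parX A k HA; rewrite addbb ok.
Qed.

Lemma super_par_even_qtr A k : super_par true A -> ~~ odd k -> qtr (A ^+ k) = 0.
Proof.
move=> HA ok; rewrite /qtr /mxtrace big1 // => i _.
rewrite mxE gr_odd_partE (@gr_part_neq _ _ false) //.
by have /(_ i i) := @super_parX A k HA; rewrite addbb (negbTE ok).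
Qed.

End SuperParity.

Lemma Odd_matrix_par (C : fieldType) n : super_par true (Odd_matrix C n).
Proof.
have even_par p q (i : 'I_p) : gr_par false (even_coord C q i).
  by apply: gr_parZ; apply: gr_par1.
have lt_n (i : 'I_n) : (n <= i)%N = false by rewrite leqNgt ltn_ord.
move=> i j; case: (split_ordP i) => i' ->; case: (split_ordP j) => j' ->.
- rewrite block_mxEul mxE /= !lt_n; exact: gr_par_gen.
- rewrite block_mxEur mxE /= leq_addr lt_n; exact: even_par.
- rewrite block_mxEdl mxE /= leq_addr lt_n; exact: even_par.
- rewrite block_mxEdr mxE /= !leq_addr; exact: gr_par_gen.
Qed.

Lemma big_nat_odd (V : nmodType) (F : nat -> V) n :
  (forall j, (0 < j <= n)%N -> F (j.*2) = 0) ->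
  \sum_(1 <= i < (n + n).+1) F i = \sum_(1 <= j < n.+1) F (j.*2.-1).
Proof.
rewrite addnn; elim: n => [|n IH] H; first by rewrite !big_geq.
rewrite doubleS big_nat_recr //= big_nat_recr //= [in RHS]big_nat_recr //=.
rewrite IH => [|j /andP[j0 jn]]; last first.
  by apply: H; rewrite j0 ltnW.
by rewrite -doubleS H ?ltnSn // addr0.
Qed.

Lemma even_coord_mx (C : fieldType) p q m (h : 'I_m -> 'I_m -> 'I_p) :
  gr_lift q (map_mx (@tofrac _) (\matrix_(i, j) ('X_(h i j) : {mpoly C[p]})))
    = \matrix_(i, j) even_coord C q (h i j).
Proof. by apply/matrixP=> i j; rewrite !mxE. Qed.

Lemma odd_coord_mx (C : fieldType) p q m (h : 'I_m -> 'I_m -> 'I_q) :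
  map_mx (gr_spec (@ratfun_const C p) setT) (\matrix_(i, j) gr_gen C (h i j))
    = \matrix_(i, j) odd_coord C p (h i j).
Proof. by apply/matrixP=> i j; rewrite !mxE gr_spec_gen inE. Qed.

Section OddParts.
Variables (C : fieldType) (n : nat).
Local Notation d := (n * n + n * n)%N.

Definition Odd_even_part : 'M[{mpoly C[d]}]_(n + n) :=
  block_mx 0 (\matrix_(i, j) 'X_(lshift _ (mxvec_index i j)))
           (\matrix_(i, j) 'X_(rshift _ (mxvec_index i j))) 0.

Definition Odd_odd_part : 'M[grassmann C d]_(n + n) :=
  block_mx (\matrix_(i, j) gr_gen C (lshift _ (mxvec_index i j))) 0
           0 (\matrix_(i, j) gr_gen C (rshift _ (mxvec_index i j))).

Lemma Odd_even_part_eval (x : 'rV[C]_d) : map_mx (meval (x 0)) Odd_even_part =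
  block_mx 0 (vec_mx (lsubmx x)) (vec_mx (rsubmx x)) 0.
Proof.
rewrite map_block_mx !map_mx0.
by congr (block_mx 0 _ _ 0); apply/matrixP=> i j; rewrite !mxE mevalXU.
Qed.

Lemma Odd_matrixE : Odd_matrix C n = gr_lift d (map_mx (@tofrac _) Odd_even_part)
  + map_mx (gr_spec (@ratfun_const C d) setT) Odd_odd_part.
Proof.
rewrite {1}/gr_lift !map_block_mx !map_mx0 add_block_mx !addr0 !add0r.
rewrite -!/(gr_lift d _).
rewrite (@even_coord_mx C d d n (fun i j => lshift _ (mxvec_index i j))).
rewrite (@even_coord_mx C d d n (fun i j => rshift _ (mxvec_index i j))).
rewrite (@odd_coord_mx C d d n (fun i j => lshift _ (mxvec_index i j))).
by rewrite (@odd_coord_mx C d d n (fun i j => rshift _ (mxvec_index i j))).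
Qed.

Lemma Odd_odd_part_par : mx_par true Odd_odd_part.
Proof.
move=> i j; rewrite mxE; case: (split_ordP i) => i' _; rewrite mxE;
  case: (split_ordP j) => j' _; rewrite mxE; by [exact: gr_par_gen | exact: gr_par0].
Qed.

End OddParts.

Section BlockEigen.
Variables (F : fieldType) (n : nat) (Y Z : 'M[F]_n).

Lemma row_lshift_antidiag i j : row i Y = delta_mx 0 j ->
  row (lshift n i) (block_mx 0 Y Z 0) = delta_mx 0 (rshift n j).
Proof. by move=> Yi; rewrite /block_mx rowKu row_row_mx row0 Yi delta_mx_rshift. Qed.

Lemma row_rshift_antidiag i j : row i Z = delta_mx 0 j ->
  row (rshift n i) (block_mx 0 Y Z 0) = delta_mx 0 (lshift n j).
Proof. by move=> Zi; rewrite /block_mx rowKd row_row_mx row0 Zi delta_mx_lshift. Qed.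

(** An eigenvector u of Y Z extends to the eigenvector (u, a^-1 u Y). Both square roots of an
    eigenvalue of Y Z thus occur, and n distinct nonzero eigenvalues yield 2n distinct ones. *)
Lemma eigenvalue_antidiag_block a : a != 0 -> eigenvalue (Y *m Z) (a ^+ 2) ->
  eigenvalue (block_mx 0 Y Z 0) a.
Proof.
move=> a0 /eigenvalueP[u uYZ u0]; apply/eigenvalueP.
exists (row_mx u (a^-1 *: (u *m Y))).
  rewrite mul_row_block !mulmx0 add0r addr0 scale_row_mx -scalemxAl -mulmxA uYZ.
  by rewrite scalerA expr2 mulKf // scalerA mulfV // scale1r.
by apply: contra_neq u0 => /(congr1 lsubmx); rewrite row_mxKl linear0.
Qed.

End BlockEigen.

Section OddExistence.
Variable (C : numClosedFieldType).

Let two_neq0 : 2%:R != 0 :> C. Proof. by rewrite pnatr_eq0. Qed.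

(** If a root equals minus another, squaring shows that both come from the same number, which is
    then 0 and excluded. *)
Lemma uniq_pm_sqrt (e : seq C) : uniq e -> 0 \notin e ->
  uniq (map sqrtC e ++ map (fun a => - sqrtC a) e).
Proof.
move=> ue e0; rewrite cat_uniq !map_inj_uniq ?ue /=.
- rewrite andbT; apply/hasPn=> _ /mapP[a ae ->]; apply/mapP=> -[b be H].
  have ab : a = b by rewrite -[a]sqrtCK -[b]sqrtCK -H sqrrN.
  have /eqP : sqrtC a = 0.
    move: H; rewrite -ab => /eqP; rewrite eq_sym -subr_eq0 opprK -mulr2n.
    by rewrite mulrn_eq0 /= => /eqP.
  by rewrite sqrtC_eq0 => /eqP a0; rewrite -a0 ae in e0.
- by move=> a b /oppr_inj /(congr1 (fun z => z ^+ 2)); rewrite !sqrtCK.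
- by move=> a b /(congr1 (fun z => z ^+ 2)); rewrite !sqrtCK.
Qed.

(* The s_j of Odd(n) is the s_(2j) of Q(2n). *)
Lemma Odd_existence n' (n := n'.+1) (d := (n * n + n * n)%N) :
  exists s : nat -> ratfun C d d,
  (forall j, gr_even (s j) /\ no_singular_points (@Odd_tilde C n) (s j)) /\
  (forall k, Odd_tau C n (k + n + 1) =
     \sum_(1 <= i < n.+1) Odd_tau C n (k + i) * s (n - i + 1)%N).
Proof.
pose sh : 'M[C]_n := \matrix_(i, j) (j == i.+1 :> nat)%:R.
(* At Y' = 1 and Z' = [sh] the block matrix shifts the basis while alternating between the two
   halves: e_0, e_n, e_1, e_(n+1), and so on. *)
pose f i : 'I_(n + n) := 
  if odd i then rshift n (inord i./2 : 'I_n) else lshift n (inord i./2 : 'I_n).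
have half_lt i : (i < n + n)%N -> (i./2 < n)%N by rewrite addnn ltn_half_double.
have [||||s [t [sE sR qt ts]]] := @ratfun_qtr_recursion C d d (n' + n'.+1) (@Odd_tilde C n)
    two_neq0 (Odd_even_part C n) (Odd_odd_part C n)
    (delta_mx 0 (f 0%N)) (row_mx (mxvec 1%:M) (mxvec sh) 0).
(* A point of the open set: Y' = 1 and Z' diagonal with entries 1, ..., n, starting at 1 because 0
   is not allowed. *)
- pose e := [tuple (i.+1 : nat)%:R : C | i < n].
  exists (row_mx (mxvec 1%:M) (mxvec (diag_mx (\row_i (i.+1 : nat)%:R)))), e.
  rewrite row_mxKl row_mxKr !mxvecK mul1mx map_inj_uniq ?enum_uniq; last first.
    by move=> i j /eqP; rewrite eqr_nat => /eqP [] /ord_inj.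
  split=> //.
    by apply/mapP=> -[i _] /eqP; rewrite eq_sym pnatr_eq0.
  apply/allP=> a /mapP[i _ ->]; apply/eigenvalueP.
  exists (delta_mx 0 i); last first.
    by apply/eqP=> /matrixP/(_ 0 i); rewrite !mxE !eqxx => /eqP; rewrite oner_eq0.
  rewrite -rowE; apply/matrixP=> a' j; rewrite !mxE [a']ord1 eqxx /=.
  by have [->|ij] := eqVneq i j; rewrite ?mulr1 ?mulr0.
- exact: Odd_odd_part_par.
- move=> x [e [ue e0 /allP ev]]; rewrite Odd_even_part_eval.
  apply: (distinct_eigenvalues_disc (uniq_pm_sqrt ue e0)).
    by rewrite size_cat !size_map size_tuple.
  have e_neq0 a : a \in e -> sqrtC a != 0.
    by move=> ae; rewrite sqrtC_eq0; apply: contraNneq e0 => <-.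
  rewrite all_cat; apply/andP; split; apply/allP=> _ /mapP[a ae ->];
    apply: (@eigenvalue_antidiag_block C n); rewrite ?oppr_eq0 ?e_neq0 ?sqrrN ?sqrtCK ?ev //.
- rewrite Odd_even_part_eval row_mxKl row_mxKr !mxvecK.
  apply: (@krylov_shift C (n' + n'.+1) _ f) => [i j Hi Hj|i Hi].
    have vf l : (l < n + n)%N -> f l = (odd l * n + l./2)%N :> nat.
      by move=> Hl; rewrite /f; case: (odd l); rewrite /= inordK ?half_lt // mul1n.
    move/(congr1 val) => /=; rewrite !vf // => H.
    rewrite -(odd_double_half i) -(odd_double_half j).
    move: H (half_lt _ Hi) (half_lt _ Hj).
    case: (odd i); case: (odd j); rewrite /= ?mul1n ?mul0n ?add0n.
    + by move/addnI => ->.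
    + by move=> <- _; rewrite ltnNge leq_addr.
    + by move=> ->; rewrite ltnNge leq_addr.
    + by move=> ->.
  rewrite /f /= uphalf_half; case: (boolP (odd i)) => oi /=.
    have i2 : (i./2.+1 < n)%N by have := half_lt _ Hi; rewrite /= uphalf_half oi.
    apply: (@row_rshift_antidiag C n); rewrite add1n.
    by apply/rowP=> j; rewrite !mxE eqxx /= inordK 1?ltnW // -val_eqE /= inordK.
  by apply: (@row_lshift_antidiag C n); rewrite row1.
have qtO k : qtr (Odd_matrix C n ^+ k.+1) = t k.+1 *+ k.+1.
  by rewrite Odd_matrixE; apply: qt.
have tauE k : Odd_tau C n k.+1 = t k.*2.+1.
  rewrite /Odd_tau mul2n doubleS subn1 /= -super_par_odd_qtr ?qtO ?scale_natr_inv //=.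
    exact: Odd_matrix_par.
  by rewrite odd_double.
have t0 k : t k.+1.*2 = 0.
  rewrite -[LHS](scale_natr_inv _ k.*2.+1) doubleS -qtO super_par_even_qtr ?scaler0 //.
    exact: Odd_matrix_par.
  by rewrite -doubleS odd_double.
exists (fun j => s j.*2); split=> [j|k]; first by split.
(* The instance of the Q(2n) recursion to use is the one at 2k, whose left side has the odd index
   2(k+n) + 1. *)
have -> : Odd_tau C n (k + n + 1) = t (k.*2 + (n' + n'.+1).+1 + 1)%N.
  by rewrite !addn1 tauE doubleD -[n.*2]addnn.
rewrite ts; apply: (etrans (@big_nat_odd _ _ n _)) => [j /andP[j0 _]|].
  by rewrite -doubleD -(prednK j0) addnS t0 mul0r.
apply: eq_big_nat => -[|i] // /andP[_ iN].
rewrite (addnS k i) tauE (doubleS i) /= (addnS k.*2) -doubleD; congr (_ * s _).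
have H : ((n + n) - i.*2.+1 + 1 = (n - i.+1 + 1).*2)%N.
  by rewrite addnn !addn1 !subnSK ?doubleB // ltn_double.
exact: H.
Qed.

End OddExistence.

(** * Nonexistence of polynomial solutions *)

(** Dividing P by (t - 1)^2 leaves degree n - 2, while the quotient still vanishes at 1, ..., n - 1:
    at 1 because the root is triple. *)
Lemma triple_root_absurd (F : numFieldType) n (P : {poly F}) : (1 < n)%N ->
  size P = n.+1 -> (forall i, (0 < i < n)%N -> root P i%:R) ->
  P^`().[1] = 0 -> P^`()^`().[1] = 0 -> False.
Proof.
move=> n1 sP rP P1 P2.
have rP1 : root P 1 by rewrite -[1]/(1%:R) rP.
have [Q1 PQ1] := factor_theorem _ _ rP1.
have dX : ('X - 1%:P : {poly F})^`() = 1 by rewrite derivXsubC.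
have rQ1 : root Q1 1.
  by move: P1; rewrite PQ1 derivM dX mulr1 !hornerE subrr mulr0 add0r => /eqP.
have [Q2 QQ2] := factor_theorem _ _ rQ1.
have rQ2 : root Q2 1.
  (* From P = Q1 (t - 1) one gets P'' = Q1'' (t - 1) + 2 Q1'. *)
  have E : P^`()^`().[1] = Q1^`().[1] *+ 2.
    by rewrite PQ1 derivM dX mulr1 derivD derivM dX mulr1 !hornerE subrr mulr0 add0r mulr2n.
  have : Q1^`().[1] == 0 by move/eqP: P2; rewrite E mulrn_eq0.
  by rewrite QQ2 derivM dX mulr1 !hornerE subrr mulr0 add0r.
have Q20 : Q2 != 0.
  by apply/eqP=> Q20; move: sP; rewrite PQ1 QQ2 Q20 !mul0r size_poly0.
have sQ2 : size Q2 = n.-1.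
  have sM (Q : {poly F}) : Q != 0 -> size (Q * ('X - 1%:P)) = (size Q).+1.
    by move=> Q0; rewrite size_Mmonic ?monicXsubC // size_XsubC addn2.
  have Q10 : Q1 != 0.
    by apply/eqP=> Q10; move: sP; rewrite PQ1 Q10 !mul0r size_poly0.
  by move: sP; rewrite PQ1 (sM _ Q10) QQ2 (sM _ Q20) => -[<-].
pose rs := [seq i%:R : F | i <- iota 1 n.-1].
have : (size rs < size Q2)%N.
  apply: max_poly_roots => //.
  - rewrite /rs; apply/allP=> _ /mapP[i Hi ->]; move: Hi.
    rewrite mem_iota add1n prednK ?(ltnW n1) // => Hi.
    have [->//|i1] := eqVneq i 1%N.
    have := rP i Hi; rewrite PQ1 QQ2 !rootM root_XsubC.
    by rewrite -[1]/(1%:R) eqr_nat (negbTE i1) !orbF.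
  - rewrite map_inj_uniq ?iota_uniq // => i j /eqP.
    by rewrite eqr_nat => /eqP.
by rewrite size_map size_iota sQ2 ltnn.
Qed.

(** * The contradiction shared by Q(n) and Odd(n) *)

Section CoreContradiction.
Variables (F : numFieldType) (q n e : nat).
Variable (gen : 'I_n -> 'I_n -> 'I_q).
Hypothesis gen_inj : forall i j i' j', gen i j = gen i' j' -> i = i' /\ j = j'.
Hypothesis n_gt1 : (1 < n)%N.
Local Notation G := (grassmann F q).
(** [tauT T] and [s T] stand for the values at the degenerate point once the odd coordinates outside
    [T] are set to zero. [sigma j S] is a coefficient of s_j at that point and therefore does not
    depend on [T]. *)
Variables (tauT : {set 'I_q} -> nat -> G) (s : {set 'I_q} -> nat -> G).
Variables (sigma : nat -> {set 'I_q} -> F).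
Hypothesis sE : forall (T S : {set 'I_q}) j, S \subset T -> s T j S = sigma j S.
Hypothesis eqT : forall T k, (k < n)%N ->
  tauT T (k + n + 1)%N = \sum_(1 <= i < n.+1) tauT T (k + i)%N * s T (n - i + 1)%N.
Hypothesis tau1 : forall (i : 'I_n) k,
  tauT [set gen i i] k.+1 = (maxn 1 i)%:R ^+ k *: gr_gen F (gen i i).
(* [e] is 0 for Q(n) and 1 for Odd(n). *)
Hypothesis tau3 : forall (i j : 'I_n) k, i != j -> (i < 2)%N -> (j < 2)%N ->
  tauT [set gen i i; gen i j; gen j i] k.+1 =
    gr_gen F (gen i i) + 'C(k + e, 2)%:R *:
      (gr_gen F (gen i i) * (gr_gen F (gen i j) * gr_gen F (gen j i))).

Let eqT0 T k : (k < n)%N ->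
  tauT T (k + n).+1 = \sum_(j < n) tauT T (k + j).+1 * s T (n - j)%N.
Proof.
move=> kn; rewrite -addn1 eqT // big_add1 big_mkord; apply: eq_bigr => j _ /=.
by rewrite addnS addn1 subnSK.
Qed.

Let P : {poly F} := 'X^n - \poly_(j < n) sigma (n - j)%N set0.

Let size_P : size P = n.+1.
Proof.
by rewrite size_polyDl size_polyXn // size_polyN ltnS size_poly.
Qed.

Let P_sum (f : nat -> F) :
  \sum_(j < n.+1) P`_j * f j = f n - \sum_(j < n) sigma (n - j)%N set0 * f j.
Proof.
rewrite big_ord_recr /= addrC !coefB coefXn eqxx coef_poly ltnn subr0 mul1r.
congr (_ + _); rewrite -sumrN; apply: eq_bigr => j _.
by rewrite coefB coefXn coef_poly ltn_ord (ltn_eqF (ltn_ord j)) sub0r mulNr.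
Qed.

Let root_P (i : 'I_n) : root P (maxn 1 i)%:R.
Proof.
apply/eqP; rewrite horner_coef size_P (P_sum (fun j => (maxn 1 i)%:R ^+ j)).
(* With a single odd coordinate left, the equation for k = 0 is exactly the vanishing of P at the
   eigenvalue. *)
have := congr1 (fun f : G => f [set gen i i]) (eqT0 [set gen i i] (ltnW n_gt1)).
rewrite /= gr_sumE add0n tau1 gr_scaleE gr_genE eqxx mulr1 => ->.
apply/eqP; rewrite subr_eq0; apply/eqP/eq_bigr=> j _.
rewrite tau1 gr_mulf_S1; last by apply: gr_parZ; apply: gr_par_gen.
by rewrite gr_scaleE gr_genE eqxx mulr1 sE ?sub0set // mulrC.
Qed.

Lemma gr_mul_top (f g : G) S : (forall A, A != S -> f A = 0) ->
  (f * g) S = f S * g set0.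
Proof.
move=> H; rewrite gr_mulE (bigD1 S) //= setDv inversions0r mul1r big1 ?addr0 //.
by move=> A /andP[_ /H->]; rewrite mul0r mulr0.
Qed.

Let W k := \sum_(j < n.+1) P`_j * 'C(k + j + e, 2)%:R.
Let kappa i j : F := (gr_gen F (gen i j) * gr_gen F (gen j i)) [set gen i j; gen j i].
Let B i j : F := \sum_(l < n) sigma (n - l)%N [set gen i j; gen j i].

(** With a, b, c the coordinates ii, ij, ji, compare coefficients of abc in the k-th equation. The
    cubic terms of the tau's meet the constant terms of the s_j and give [W]; the linear term a
    meets their bc-terms and gives [B]. The sign of bc against the ordered monomial is [kappa]. *)
Let W_kappa (i j : 'I_n) k : i != j -> (i < 2)%N -> (j < 2)%N -> (k < n)%N ->
  kappa i j * W k = B i j.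
Proof.
move=> ij i2 j2 kn.
set T := [set gen i i; gen i j; gen j i].
have iT : gen i i \in T by rewrite !inE eqxx.
have TD : T :\ gen i i = [set gen i j; gen j i].
  have n1 : gen i j != gen i i by apply: contraNneq ij => /gen_inj[_ ->].
  have n2 : gen j i != gen i i by apply: contraNneq ij => /gen_inj[->].
  apply/setP=> x; rewrite !inE; have [->|//] := eqVneq x (gen i i).
  by rewrite eq_sym (negbTE n1) eq_sym (negbTE n2).
pose abc := gr_gen F (gen i i) * (gr_gen F (gen i j) * gr_gen F (gen j i)).
pose eps : F := (-1) ^+ inversions [set gen i i] (T :\ gen i i).
have abcT : abc T = eps * kappa i j by rewrite /abc gr_genM // /eps TD.
have abc0 A : A != T -> abc A = 0.
  move=> AT; case: (boolP (gen i i \in A)) => iA; last first.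
    rewrite /abc gr_mulE big1 // => A' A'A; rewrite gr_genE.
    by have [E|_] := eqVneq A' _; rewrite ?mul0r ?mulr0 //; rewrite -sub1set -E A'A in iA.
  rewrite /abc gr_genM // gr_gen_mul gr_scaleE [X in _ * (_ * X)]ffunE.
  have [E|_] := eqVneq (A :\ gen i i) _; last by rewrite andbF !mulr0.
  by rewrite -(setD1K iA) E -TD setD1K ?eqxx in AT.
have aT : gr_gen F (gen i i) T = 0.
  rewrite gr_genE; have [E|//] := eqVneq T _.
  have : gen i j \in T by rewrite !inE eqxx orbT.
  by rewrite E inE => /eqP /gen_inj[_ /eqP]; rewrite eq_sym (negbTE ij).
have := congr1 (fun f : G => f T) (eqT0 T kn).
rewrite /= gr_sumE tau3 // gr_addE gr_scaleE aT add0r abcT => H.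
have eps0 : eps != 0 by rewrite signr_eq0.
apply: (mulfI eps0); rewrite /W (P_sum (fun l => 'C(k + l + e, 2)%:R)).
rewrite mulrBr mulrBr mulrA [X in X - _]mulrC H /B; apply/eqP.
rewrite subr_eq !mulr_sumr -big_split /=; apply/eqP/eq_bigr=> l _.
rewrite tau3 // mulrDl gr_addE gr_genM // TD sE ?subsetDl //.
  rewrite -scalerAl gr_scaleE gr_mul_top // sE ?sub0set // abcT -/eps.
  by rewrite /eps TD; move: (kappa i j) ((-1) ^+ _) => x y; ring.
by rewrite -TD subsetDl.
Qed.

(** Exchanging the two indices changes the sign of [kappa], since bc = - cb, but not [B], which sees
    only the set of the two coordinates. Hence [kappa * W k] is its own negative, and [kappa] is 1
    or -1. *)
Let W0 k : (k < n)%N -> W k = 0.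
Proof.
move=> kn; have n0 := ltnW n_gt1.
pose i0 := Ordinal n0; pose i1 := Ordinal n_gt1.
have := W_kappa (i := i0) (j := i1) isT isT isT kn.
have := W_kappa (i := i1) (j := i0) isT isT isT kn.
have -> : B i1 i0 = B i0 i1 by rewrite /B setUC.
have -> : kappa i1 i0 = - kappa i0 i1.
  by rewrite /kappa setUC gr_gen_anticomm gr_oppE.
move=> <- /eqP; rewrite mulNr -addr_eq0 -mulr2n mulrn_eq0 /= mulf_eq0.
case/orP=> [/eqP k0|/eqP //]; exfalso; move: k0; rewrite /kappa gr_gen_mul gr_scaleE.
rewrite [X in _ * X]ffunE eqxx andbT => /eqP; rewrite mulf_eq0 signr_eq0 /=.
have -> : gen i0 i1 != gen i1 i0 by apply/eqP=> /gen_inj[] /(congr1 val).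
by rewrite oner_eq0.
Qed.

Theorem core_contradiction : False.
Proof.
have PE0 : P.[1] = 0.
  by have /eqP := root_P (Ordinal n_gt1).
have hornerS (Q : {poly F}) N : (size Q <= N)%N -> Q.[1] = \sum_(j < N) Q`_j.
  move=> sQ; rewrite (horner_coef_wide _ sQ); apply: eq_bigr => j _.
  by rewrite expr1n mulr1.
have d1 : P^`().[1] = \sum_(j < n.+1) P`_j * j%:R.
  rewrite (hornerS _ n) ?size_poly_deriv; last first.
    by rewrite -ltnS -size_P lt_size_deriv // -size_poly_gt0 size_P.
  rewrite big_ord_recl mulr0 add0r; apply: eq_bigr => j _.
  by rewrite coef_deriv mulr_natr.
have sd (Q : {poly F}) N : (size Q <= N)%N -> (size Q^`() <= N)%N.
  by move=> sQ; apply: leq_trans sQ; apply: leq_trans (size_poly _ _) (leq_pred _).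
have P0 j : (n < j)%N -> P`_j = 0 by move=> nj; rewrite nth_default ?size_P.
have d2 : P^`()^`().[1] = (\sum_(j < n.+1) P`_j * 'C(j, 2)%:R) *+ 2.
  rewrite (hornerS _ n.+1) ?sd ?size_P // -sumrMnl.
  transitivity (\sum_(0 <= j < n.+3) P`_j * 'C(j, 2)%:R *+ 2).
    rewrite big_nat_recl // big_nat_recl // !bin_small // !mulr0 !mul0rn !add0r big_mkord.
    apply: eq_bigr => j _; rewrite !coef_deriv mulr_natr -!mulrnA; congr (_ *+ _).
    by rewrite [RHS]mulnC -(mul_bin_diag j.+2 1) bin1.
  by rewrite big_mkord 2!big_ord_recr /= !P0 ?ltnS // !mul0r !mul0rn !addr0.
have e1 : \sum_(j < n.+1) P`_j = 0 by rewrite -(hornerS P n.+1) ?size_P.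
have bin_add l : 'C(l + e, 2) = ('C(l, 2) + l * e + 'C(e, 2))%N.
  elim: e => [|e' IH]; first by rewrite !addn0 muln0 addn0.
  by rewrite addnS !binS !bin1 IH mulnS; lia.
(* As C(j+1+e, 2) - C(j+e, 2) = j + e, the difference [W 1 - W 0] is P'(1) + e P(1), and P(1) =
   0. *)
have dP : P^`().[1] = 0.
  have := W0 n_gt1; have := W0 (ltnW n_gt1); rewrite /W => w0.
  under eq_bigr => j _ do rewrite add1n addSn binS bin1 natrD mulrDr natrD mulrDr.
  rewrite !big_split /= w0 add0r -d1 -mulr_suml e1 mul0r addr0.
  by [].
apply: (triple_root_absurd n_gt1 size_P) => //.
- move=> i /andP[i0 iN]; have := root_P (Ordinal iN).
  by rewrite /= (maxn_idPr i0).
(* By [bin_add], [W 0] is P''(1)/2 plus multiples of P'(1) and P(1), which vanish. *)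
- rewrite d2; have := W0 (ltnW n_gt1); rewrite /W.
  under eq_bigr => j _ do rewrite add0n bin_add !natrD !mulrDr natrM mulrA.
  rewrite !big_split /= -!mulr_suml e1 -d1 dP !mul0r !addr0 => ->.
  by rewrite mul0rn.
Qed.

End CoreContradiction.

(** * Powers of a diagonal matrix with a nilpotent perturbation *)

Section NilpotentPowers.
Variables (T : pzRingType) (D h : T).
Hypothesis Dh : D * h = h.
Hypothesis hD : h * D = h.
Hypothesis h4 : h * h * h * h = 0.

Let h3h : h ^+ 3 * h = 0. Proof. by rewrite -exprSr !exprS mulr1 !mulrA. Qed.
Let h2h : h ^+ 2 * h = h ^+ 3. Proof. by rewrite -exprSr. Qed.
Let Xh k : h ^+ k.+1 * D = h ^+ k.+1. Proof. by rewrite exprSr -mulrA hD. Qed.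

Lemma fixed_mulX k : D ^+ k * h = h.
Proof. by elim: k => [|k IH]; rewrite ?mul1r // exprSr -mulrA Dh. Qed.

(** [D] acts as the identity on [h] from both sides, so every mixed monomial is a power of [h]: the
    binomial formula holds and stops at the cube. *)
Lemma exprD_nil4 k :
  (D + h) ^+ k = D ^+ k + h *+ k + h ^+ 2 *+ 'C(k, 2) + h ^+ 3 *+ 'C(k, 3).
Proof.
elim: k => [|k IH]; first by rewrite !expr0 !mulr0n !addr0.
rewrite exprSr IH mulrDr !mulrDl !mulrnAl -exprSr hD (Xh 1) (Xh 2).
rewrite fixed_mulX -expr2 h2h h3h !binS bin1 mul0rn addr0.
by rewrite !mulrnDr mulrSr [LHS](AC (4*3) ((1*(2*5))*(3*6)*(4*7))).
Qed.

End NilpotentPowers.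

Section CompanionPowers.
Variables (R : nzRingType) (n : nat).
Implicit Types D h : 'M[R]_n.

Let companion D h : 'M[R]_(n + n) := block_mx h D 1%:M 0.

Let companion_sq D h : companion D h * companion D h = block_mx (h * h + D) (h * D) h D.
Proof. by rewrite -mulmxE mulmx_block !mulmx1 !mul1mx !mulmx0 !addr0. Qed.

Let exp_double (T : pzRingType) (x : T) k : x ^+ k.*2 = (x * x) ^+ k.
Proof. by rewrite -muln2 mulnC exprM expr2. Qed.

Lemma companion_trace_nil2 D h d k :
    D * h = h *+ d -> h * D = h *+ d -> h * h = 0 ->
  \tr (companion D h ^+ k.*2.+1) = \tr h *+ (k.*2.+1 * d ^ k).
Proof.
move=> Dh hD hh.
have Dkh j : D ^+ j * h = h *+ d ^ j.
  elim: j => [|j IH]; first by rewrite mul1r.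
  by rewrite exprS -mulrA IH mulrnAr Dh -mulrnA expnS.
(* The lower left block is k d^(k-1) h. It is described through its products, which avoids the
   exponent k - 1 at k = 0. *)
have [L [defA LD Lh]] : exists L, [/\ companion D h ^+ k.*2 =
    block_mx (D ^+ k) (h *+ (k * d ^ k)) L (D ^+ k), L * D = h *+ (k * d ^ k) & L * h = 0].
  rewrite exp_double companion_sq hh add0r hD.
  elim: k => [|k [L [IH LD Lh]]].
    by exists 0; rewrite !mul0r expr0 mul0n mulr0n -scalar_mx_block.
  exists (h *+ (k.+1 * d ^ k)); split; last by rewrite mulrnAl hh mul0rn.
    rewrite exprSr IH -mulmxE mulmx_block !mulmxE !mulrnAr !mulrnAl hh hD Lh Dkh LD.
    rewrite !mul0rn !addr0 add0r -exprSr -!mulrnA -!mulrnDr.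
    by congr (block_mx _ (h *+ _) (h *+ _) _); rewrite ?expnSr; lia.
  by rewrite mulrnAl hD -mulrnA; congr (_ *+ _); rewrite expnS; lia.
rewrite exprSr defA -mulmxE mulmx_block mxtrace_block !mulmxE !mulr1 !mulr0 addr0.
by rewrite Dkh LD -mulrnDr -raddfD -mulrnDr raddfMn; congr (_ *+ _); lia.
Qed.

(** The blocks of an even power are D^k plus a multiple of h^2 on the diagonal and combinations of h
    and h^3 off it; Pascal's rule propagates the coefficients. *)
Lemma companion_trace_nil4 D h k :
    D * h = h -> h * D = h -> h * h * h * h = 0 ->
  \tr (companion D h ^+ k.*2.+1) =
    \tr h *+ k.*2.+1 + \tr (h ^+ 3) *+ ('C(k.+1, 2) + 'C(k.+1, 3).*2).
Proof.
move=> Dh hD h4.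
have h3h : h ^+ 3 * h = 0 by rewrite -exprSr !exprS mulr1 !mulrA.
have h2D : h ^+ 2 * D = h ^+ 2 by rewrite expr2 -mulrA hD.
have h3D : h ^+ 3 * D = h ^+ 3 by rewrite exprSr -mulrA hD.
have h2h2 : h ^+ 2 * h ^+ 2 = 0 by rewrite -exprD exprSr h3h.
have h3h2 : h ^+ 3 * h ^+ 2 = 0 by rewrite expr2 mulrA h3h mul0r.
have Dkh j : D ^+ j * h = h by apply: fixed_mulX.
have Dkh2 j : D ^+ j * h ^+ 2 = h ^+ 2 by rewrite expr2 mulrA Dkh.
have defA : companion D h ^+ k.*2 = block_mx
    (D ^+ k + h ^+ 2 *+ 'C(k.+1, 2)) (h *+ k + h ^+ 3 *+ 'C(k.+1, 3))
    (h *+ k + h ^+ 3 *+ 'C(k.+1, 3)) (D ^+ k + h ^+ 2 *+ 'C(k, 2)).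
  rewrite exp_double companion_sq hD -expr2.
  elim: k => [|k IH].
    by rewrite expr0 !mulr0n !addr0 -scalar_mx_block.
  rewrite exprSr IH -mulmxE mulmx_block !mulmxE !(mulrDl, mulrDr) !mulrnAl.
  rewrite !Dkh !Dkh2 hD h2D h3D h2h2 h3h h3h2 -!exprSr -expr2.
  rewrite !mul0rn !addr0 !add0r.
  rewrite -(exprS h 2) (binS k.+1 2) (binS k.+1 1) (binS k 1) !bin1 !mulrnDr (mulrSr h).
  congr (block_mx _ _ _ _).
  - by rewrite mulrS [LHS](AC ((2*2)*1) (2*((3*4)*(1*5)))).
  - by rewrite [LHS](AC ((1*2)*2) ((4*1)*(5*(2*3)))).
  - by rewrite [LHS](AC (3*2) ((2*4)*(3*(5*1)))).
  - by rewrite [LHS](AC (1*2) (2*(3*1))).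
rewrite exprSr defA -mulmxE mulmx_block mxtrace_block !mulmxE !mulr1 !mulr0 addr0.
move: 'C(k.+1, 2) 'C(k.+1, 3) => x y.
rewrite !mulrDl !mulrnAl Dkh hD h3D -exprSr !raddfD !raddfMn /=.
by rewrite mulrS -!addnn !mulrnDr [LHS](AC ((2*2)*2) ((1*(3*5))*(2*(4*6)))).
Qed.

End CompanionPowers.

Section ScaledDelta.
Variables (R : nzRingType) (n : nat).

Lemma scale_delta_mul (x y : R) (i j k l : 'I_n) :
  (x *: delta_mx i j) * (y *: delta_mx k l) = (x * y) *: delta_mx i l *+ (j == k).
Proof.
rewrite -mulmxE -scalemxAl.
have -> : delta_mx i j *m (y *: delta_mx k l) = y *: (delta_mx i j *m delta_mx k l).
  apply/matrixP=> r t; rewrite !mxE mulr_sumr; apply: eq_bigr => u _.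
  by rewrite !mxE !mulrA; congr (_ * _); rewrite mulr_natl mulr_natr.
by rewrite mul_delta_mx_cond scalerA scalerMnr.
Qed.

Lemma mxtrace_scale_delta (x : R) (i j : 'I_n) : \tr (x *: delta_mx i j) = x *+ (i == j).
Proof.
rewrite mxtraceZ /mxtrace (bigD1 i) //= mxE eqxx /= big1 => [|k ki].
  by rewrite addr0 mulr_natr.
by rewrite mxE (negbTE ki).
Qed.

Variables (a b c : R) (i j : 'I_n).
Hypothesis ij : i != j.
Hypotheses (aa : a * a = 0) (bb : b * b = 0) (cc : c * c = 0).
Hypotheses (ba : b * a = - (a * b)) (ca : c * a = - (a * c)) (cb : c * b = - (b * c)).

Definition corner_mx : 'M[R]_n :=
  a *: delta_mx i i + b *: delta_mx i j + c *: delta_mx j i.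

Lemma corner_mx_sq : corner_mx ^+ 2 =
  (b * c) *: delta_mx i i + (a * b) *: delta_mx i j
  + (c * a) *: delta_mx j i + (c * b) *: delta_mx j j.
Proof.
rewrite expr2 /corner_mx !mulrDl !mulrDr !scale_delta_mul !eqxx (negbTE ij).
rewrite eq_sym (negbTE ij) aa bb cc !mulr1n !mulr0n scale0r !addr0 !add0r.
by rewrite [LHS](AC (2*2) ((2*1)*3*4)).
Qed.

(** Cyclic permutations of three letters are even, so bca = cab = abc; any product repeating a
    letter vanishes. *)
Lemma corner_mx_cube : corner_mx ^+ 3 =
  (a * (b * c)) *: delta_mx i i *+ 2 + (a * (b * c)) *: delta_mx j j.
Proof.
have bca : b * (c * a) = a * (b * c).
  by rewrite ca mulrN (mulrA b) ba mulNr opprK -mulrA.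
have cab : c * (a * b) = a * (b * c).
  by rewrite (mulrA c) ca mulNr -(mulrA a) cb mulrN opprK.
have bcb : b * (c * b) = 0 by rewrite cb mulrN mulrA bb mul0r oppr0.
have aab : a * (a * b) = 0 by rewrite mulrA aa mul0r.
have cbc : c * (b * c) = 0 by rewrite mulrA cb mulNr -mulrA cc mulr0 oppr0.
rewrite exprS corner_mx_sq /corner_mx !mulrDl !mulrDr !scale_delta_mul !eqxx (negbTE ij).
rewrite eq_sym (negbTE ij) !mulr1n !mulr0n !addr0 !add0r bca cab bcb aab cbc.
rewrite !scale0r !addr0 mulr2n.
by rewrite add0r.
Qed.

Lemma corner_mx_nil : corner_mx * corner_mx * corner_mx * corner_mx = 0.
Proof.
have -> : corner_mx * corner_mx * corner_mx * corner_mx = corner_mx * corner_mx ^+ 3.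
  by rewrite !exprS mulr1 !mulrA.
have aabc : a * (a * (b * c)) = 0 by rewrite mulrA aa mul0r.
have babc : b * (a * (b * c)) = 0.
  by rewrite mulrA ba mulNr -mulrA [b * (b * c)]mulrA bb mul0r mulr0 oppr0.
have cabc : c * (a * (b * c)) = 0.
  by rewrite mulrA ca mulNr -mulrA [c * (b * c)]mulrA cb mulNr -mulrA cc !mulr0 oppr0 mulr0 oppr0.
rewrite corner_mx_cube /corner_mx !mulrDl !mulrDr !scale_delta_mul.
by rewrite aabc babc cabc !scale0r !mul0rn !addr0.
Qed.

Lemma corner_mx_trace : \tr corner_mx = a.
Proof.
rewrite /corner_mx !raddfD /= !mxtrace_scale_delta eqxx (negbTE ij) eq_sym (negbTE ij).
by rewrite !addr0.
Qed.

Lemma corner_mx_trace_cube : \tr (corner_mx ^+ 3) = a * (b * c) *+ 3.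
Proof.
by rewrite corner_mx_cube raddfD raddfMn /= !mxtrace_scale_delta !eqxx -mulrSr.
Qed.

End ScaledDelta.

Lemma diag_nat_mul (R : nzRingType) n (d : 'I_n -> nat) (x : R) (i j : 'I_n) :
  diag_mx (\row_(k < n) (d k)%:R) * (x *: delta_mx i j) = x *: delta_mx i j *+ d i.
Proof.
rewrite -mulmxE mul_diag_mx; apply/matrixP=> k l; rewrite !mxE mulmxnE !mxE.
by have [->|_] := eqVneq k i; rewrite ?mulr0 ?mul0rn // mulr_natl.
Qed.

Lemma mul_diag_nat (R : nzRingType) n (d : 'I_n -> nat) (x : R) (i j : 'I_n) :
  (x *: delta_mx i j) * diag_mx (\row_(k < n) (d k)%:R) = x *: delta_mx i j *+ d j.
Proof.
rewrite -mulmxE mul_mx_diag; apply/matrixP=> k l; rewrite !mxE mulmxnE !mxE.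
by have [->|_] := eqVneq l j; rewrite ?andbF ?mulr0 ?mul0r ?mul0rn // mulr_natr.
Qed.

Section RestrictedGenerators.
Variables (K : comNzRingType) (q n : nat) (gen : 'I_n -> 'I_n -> 'I_q).
Hypothesis gen_inj : forall i j i' j', gen i j = gen i' j' -> i = i' /\ j = j'.
Local Notation x := (fun i j => gr_gen K (gen i j)).

Definition restricted_gens (T : {set 'I_q}) : 'M[grassmann K q]_n :=
  \matrix_(i, j) (if gen i j \in T then gr_gen K (gen i j) else 0).

Let genE i j k l : (gen i j == gen k l) = (i == k) && (j == l).
Proof.
by apply/eqP/andP=> [/gen_inj[-> ->]|[/eqP-> /eqP->]].
Qed.

Lemma restricted_gens1 i : restricted_gens [set gen i i] = x i i *: delta_mx i i.
Proof.
apply/matrixP=> k l; rewrite !mxE inE genE.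
by case: eqVneq => [->|_]; case: eqVneq => [->|_]; rewrite ?mulr1 ?mulr0.
Qed.

Lemma restricted_gens3 i j : i != j ->
  restricted_gens [set gen i i; gen i j; gen j i] = corner_mx (x i i) (x i j) (x j i) i j.
Proof.
move=> ij; apply/matrixP=> k l; rewrite !mxE !inE !genE.
have [->|ki] := eqVneq k i; have [->|li] := eqVneq l i;
  rewrite ?(negbTE ij) ?eqxx /= ?andbF ?andbT ?orbF /= ?mulr1 ?mulr0 ?addr0 ?add0r //.
  by have [->|lj] := eqVneq l j; rewrite ?mulr1 ?mulr0.
by have [->|kj] := eqVneq k j; rewrite ?mulr1 ?mulr0.
Qed.

End RestrictedGenerators.

(** * Evaluation of polynomial solutions at a point *)

Section Specialize.
Variables (F : numFieldType) (p q : nat).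
Local Notation R := {mpoly F[p]}.
Local Notation K := {fraction {mpoly F[p]}}.
Local Notation toK := (gr_spec (@tofrac R) (setT : {set 'I_q})).

Lemma polynomial_fun_lift (s : ratfun F p q) : polynomial_fun s ->
  exists g : grassmann R q, s = toK g.
Proof.
move=> /choice[f fE]; exists [ffun S : {set 'I_q} => f S].
by apply/ffunP=> S; rewrite gr_specE subsetT ffunE fE.
Qed.

Lemma toK_inj : injective toK.
Proof.
move=> f g /ffunP H; apply/ffunP=> S; have := H S; rewrite !gr_specE subsetT.
by move/eqP; rewrite tofrac_eq => /eqP.
Qed.

Variables (m n : nat) (A : 'M[grassmann R q]_m) (e : nat -> nat) (y : 'I_p -> F).
Local Notation AK := (map_mx toK A).
Definition special_mx (T : {set 'I_q}) := map_mx (gr_spec (meval y) T) A.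

(** Polynomiality enters here: the equations descend from the fraction field to polynomials and can
    then be evaluated at an arbitrary [y], even where rational solutions would have poles. The
    exponent [e k] is k for Q(n) and 2k - 1 for Odd(n). *)
Lemma specialize_recursion (s : nat -> ratfun F p q) :
    (forall j, (1 <= j <= n)%N -> polynomial_fun (s j)) ->
    (forall k, (k < n)%N -> (e (k + n + 1)%N)%:R^-1 *: qtr (AK ^+ e (k + n + 1)%N) =
      \sum_(1 <= i < n.+1) ((e (k + i)%N)%:R^-1 *: qtr (AK ^+ e (k + i)%N)) * s (n - i + 1)%N) ->
  exists g : nat -> grassmann R q, forall T k, (k < n)%N ->
    (e (k + n + 1)%N)%:R^-1 *: qtr (special_mx T ^+ e (k + n + 1)%N) =
      \sum_(1 <= i < n.+1) ((e (k + i)%N)%:R^-1 *: qtr (special_mx T ^+ e (k + i)%N))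
         * gr_spec (meval y) T (g (n - i + 1)%N).
Proof.
move=> polys eqK.
have /choice[g gE] : forall j, exists g, (1 <= j <= n)%N -> s j = toK g.
  move=> j; case: (boolP (1 <= j <= n)%N) => [/polys/polynomial_fun_lift[g ->]|_].
    by exists g.
  by exists 0.
exists g => T k kn.
(* The factor 1/j is a constant, hence already a polynomial; j = 0 causes no trouble, as the inverse
   of 0 is 0 on both sides. *)
pose c j : R := ((j%:R)^-1)%:MP.
have cK j : tofrac (c j) = (j%:R)^-1 :> K.
  by rewrite -[LHS]/(@ratfun_const F p (j%:R)^-1) fmorphV rmorph_nat.
have cF j : (c j).@[y] = (j%:R)^-1 by rewrite mevalC.
have tauK j : (j%:R)^-1 *: qtr (AK ^+ j) = toK (c j *: qtr (A ^+ j)).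
  by rewrite gr_specZ gr_spec_qtr map_gr_specX -cK.
have tauF j : (j%:R)^-1 *: qtr (special_mx T ^+ j) = gr_spec (meval y) T (c j *: qtr (A ^+ j)).
  by rewrite gr_specZ gr_spec_qtr map_gr_specX -cF.
have /toK_inj eqR : toK (c (e (k + n + 1)%N) *: qtr (A ^+ e (k + n + 1)%N)) =
    toK (\sum_(1 <= i < n.+1) (c (e (k + i)%N) *: qtr (A ^+ e (k + i)%N)) * g (n - i + 1)%N).
  rewrite -tauK eqK // rmorph_sum; apply: eq_big_nat => i /andP[i1 iN].
  by rewrite tauK gE ?rmorphM //; lia.
rewrite tauF eqR rmorph_sum; apply: eq_bigr => i _.
by rewrite tauF rmorphM.
Qed.

Lemma special_even (T : {set 'I_q}) a (h : 'I_a -> 'I_a -> 'I_p) :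
  map_mx (gr_spec (meval y) T) (\matrix_(i, j) ('X_(h i j) : R)%:A)
    = gr_lift q (\matrix_(i, j) y (h i j)).
Proof. by apply/matrixP=> i j; rewrite !mxE gr_specZ /= mevalXU rmorph1. Qed.

Lemma special_gens (R1 R2 : comNzRingType) (phi : {rmorphism R1 -> R2})
    (T : {set 'I_q}) a (h : 'I_a -> 'I_a -> 'I_q) :
  map_mx (gr_spec phi T) (\matrix_(i, j) gr_gen R1 (h i j)) = restricted_gens R2 h T.
Proof. by apply/matrixP=> i j; rewrite !mxE gr_spec_gen. Qed.

Lemma toK_even a (h : 'I_a -> 'I_a -> 'I_p) :
  map_mx toK (\matrix_(i, j) ('X_(h i j) : R)%:A) = \matrix_(i, j) even_coord F q (h i j).
Proof. by apply/matrixP=> i j; rewrite !mxE gr_specZ rmorph1. Qed.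

Lemma toK_gens a (h : 'I_a -> 'I_a -> 'I_q) :
  map_mx toK (\matrix_(i, j) gr_gen R (h i j)) = \matrix_(i, j) odd_coord F p (h i j).
Proof. by apply/matrixP=> i j; rewrite !mxE gr_spec_gen inE. Qed.

End Specialize.

Section DegeneratePoint.
Variables (F : numFieldType) (q n : nat).
Local Notation G := (grassmann F q).

(* Eigenvalues 1, 1, 2, ..., n-1. *)
Definition special_diag : 'M[F]_n := diag_mx (\row_(k < n) (maxn 1 k)%:R).

Lemma gr_lift_special_diag : gr_lift q special_diag = diag_mx (\row_(k < n) (maxn 1 k)%:R).
Proof.
rewrite /gr_lift /special_diag map_diag_mx; congr diag_mx.
by apply/rowP=> k; rewrite !mxE rmorph_nat.
Qed.

Variable gen : 'I_n -> 'I_n -> 'I_q.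
Hypothesis gen_inj : forall i j i' j', gen i j = gen i' j' -> i = i' /\ j = j'.
Local Notation x i j := (gr_gen F (gen i j)).
Local Notation D := (gr_lift q special_diag).

Section OneGenerator.
Variable i : 'I_n.
Local Notation h := (restricted_gens F gen [set gen i i]).

Lemma restricted_gens1_relations :
  [/\ D * h = h *+ maxn 1 i, h * D = h *+ maxn 1 i, h * h = 0 & \tr h = x i i].
Proof.
rewrite restricted_gens1 // gr_lift_special_diag; split.
- exact: diag_nat_mul.
- exact: mul_diag_nat.
- by rewrite scale_delta_mul gr_gen_sq scale0r mul0rn.
- by rewrite mxtrace_scale_delta eqxx.
Qed.
End OneGenerator.

Section ThreeGenerators.
Variables i j : 'I_n.
Hypotheses (ij : i != j) (i2 : (i < 2)%N) (j2 : (j < 2)%N).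
Local Notation h := (restricted_gens F gen [set gen i i; gen i j; gen j i]).

(** Both indices are below 2, so [h] lives in the eigenspace for the double eigenvalue 1, where [D]
    is the identity. *)
Lemma restricted_gens3_relations : [/\ D * h = h, h * D = h, h * h * h * h = 0, \tr h = x i i &
  \tr (h ^+ 3) = x i i * (x i j * x j i) *+ 3].
Proof.
have max2 (k : 'I_n) : (k < 2)%N -> maxn 1 k = 1%N by case: k => -[|[|]].
rewrite restricted_gens3 // gr_lift_special_diag; split.
- by rewrite /corner_mx !mulrDr !(diag_nat_mul (fun k : 'I_n => maxn 1 k)) !max2.
- by rewrite /corner_mx !mulrDl !(mul_diag_nat (fun k : 'I_n => maxn 1 k)) !max2.
- by apply: corner_mx_nil; rewrite ?gr_gen_sq //; apply: gr_gen_anticomm.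
- exact: corner_mx_trace.
- by apply: corner_mx_trace_cube; rewrite ?gr_gen_sq //; apply: gr_gen_anticomm.
Qed.
End ThreeGenerators.

Lemma gr_lift_par m (X : 'M[F]_m) : mx_par false (gr_lift q X).
Proof. by move=> k l; rewrite mxE; apply: gr_parZ; apply: gr_par1. Qed.

Lemma restricted_gens_par T : mx_par true (restricted_gens F gen T).
Proof.
by move=> k l; rewrite mxE; case: ifP => _; [apply: gr_par_gen | apply: gr_par0].
Qed.

Let natr_inv_scale k (f : G) : k.+1%:R^-1 *: (f *+ k.+1) = f.
Proof. by rewrite -scaler_nat scalerA mulVf ?scale1r // pnatr_eq0. Qed.

Lemma Q_special1 i k : let h := restricted_gens F gen [set gen i i] in
  k.+1%:R^-1 *: qtr ((D + h) ^+ k.+1) = (maxn 1 i)%:R ^+ k *: x i i.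
Proof.
move=> h; have [Dh hD hh tr_h] := restricted_gens1_relations i.
have Dkh l : D ^+ l * h = h *+ maxn 1 i ^ l.
  elim: l => [|l IH]; first by rewrite mul1r.
  by rewrite exprS -mulrA IH mulrnAr Dh -mulrnA expnS.
rewrite exprD_nil2 ?Dh ?hD // raddfD raddfMn /= Dkh raddfMn /=.
rewrite (qtr_par_even (mx_par_evenX _ (gr_lift_par _))) add0r natr_inv_scale.
by rewrite (qtr_par_odd (restricted_gens_par _)) tr_h -natrX scaler_nat.
Qed.

Lemma Q_special3 (i j : 'I_n) k : i != j -> (i < 2)%N -> (j < 2)%N ->
  let h := restricted_gens F gen [set gen i i; gen i j; gen j i] in
  k.+1%:R^-1 *: qtr ((D + h) ^+ k.+1) =
    x i i + 'C(k + 0, 2)%:R *: (x i i * (x i j * x j i)).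
Proof.
move=> ij i2 j2 h; have [Dh hD h4 tr_h tr_h3] := restricted_gens3_relations ij i2 j2.
have Hh : mx_par true h by apply: restricted_gens_par.
have H2 : mx_par false (h ^+ 2) by apply: (mx_parM Hh Hh).
have H3 : mx_par true (h ^+ 3) by rewrite exprS; apply: (mx_parM Hh H2).
rewrite exprD_nil4 // addn0.
(* The cubic coefficient comes from 3 C(k+1, 3) = (k+1) C(k, 2). *)
move: (mul_bin_diag k.+1 2); rewrite -pred_Sn.
move: 'C(k.+1, 2) 'C(k.+1, 3) 'C(k, 2) => u w z wz; rewrite !raddfD !raddfMn /=.
rewrite (qtr_par_even H2) (qtr_par_even (mx_par_evenX _ (gr_lift_par _))).
rewrite (qtr_par_odd Hh) (qtr_par_odd H3) tr_h tr_h3 !scaler0 mul0rn add0r addr0.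
by rewrite !scalerMnr -mulrnA -wz mulnC mulrnA !natr_inv_scale scaler_nat.
Qed.

Section Companion.
Variable h : 'M[G]_n.
Hypothesis Hh : mx_par true h.
Local Notation A := (block_mx h D 1%:M 0).

Lemma companion_par : super_par true A.
Proof.
have lt_n (i : 'I_n) : (n <= i)%N = false by rewrite leqNgt ltn_ord.
move=> i j; case: (split_ordP i) => i' ->; case: (split_ordP j) => j' ->.
- by rewrite block_mxEul /= !lt_n; apply: Hh.
- by rewrite block_mxEur /= leq_addr lt_n; apply: gr_lift_par.
- by rewrite block_mxEdl /= leq_addr lt_n; apply: mx_par1.
- by rewrite block_mxEdr mxE; apply: gr_par0.
Qed.

Lemma companion_qtr k : qtr (A ^+ k.*2.+1) = \tr (A ^+ k.*2.+1).
Proof.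
rewrite super_par_odd_qtr ?odd_str_trace //; first exact: companion_par.
by rewrite /= odd_double.
Qed.
End Companion.

Lemma Odd_special1 i k : let h := restricted_gens F gen [set gen i i] in
  k.*2.+1%:R^-1 *: qtr (block_mx h D 1%:M 0 ^+ k.*2.+1) = (maxn 1 i)%:R ^+ k *: x i i.
Proof.
move=> h; have [Dh hD hh tr_h] := restricted_gens1_relations i.
rewrite companion_qtr; last exact: restricted_gens_par.
rewrite (companion_trace_nil2 _ Dh hD hh) tr_h mulnC mulrnA natr_inv_scale.
by rewrite -natrX scaler_nat.
Qed.

Lemma Odd_special3 (i j : 'I_n) k : i != j -> (i < 2)%N -> (j < 2)%N ->
  let h := restricted_gens F gen [set gen i i; gen i j; gen j i] in
  k.*2.+1%:R^-1 *: qtr (block_mx h D 1%:M 0 ^+ k.*2.+1) =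
    x i i + 'C(k + 1, 2)%:R *: (x i i * (x i j * x j i)).
Proof.
move=> ij i2 j2 h; have [Dh hD h4 tr_h tr_h3] := restricted_gens3_relations ij i2 j2.
rewrite companion_qtr; last exact: restricted_gens_par.
rewrite (companion_trace_nil4 _ Dh hD h4) tr_h tr_h3 -mulrnA.
(* Because 3 C(k+1, 3) = (k-1) C(k+1, 2), the total factor is 3 + 2(k-1) = 2k + 1, cancelled by the
   normalisation of tau. What remains is C(k+1, 2), so the shift [e] is 1 here. *)
have -> : (3 * ('C(k.+1, 2) + 'C(k.+1, 3).*2) = 'C(k.+1, 2) * k.*2.+1)%N.
  case: k => [|k]; first by rewrite !bin_small.
  have := mul_bin_left k.+2 2; rewrite subn2 /=.
  by move: 'C(k.+2, 2) 'C(k.+2, 3) => u w; rewrite -!muln2; nia.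
by rewrite mulrnA -mulrnDl natr_inv_scale scaler_nat addn1.
Qed.

End DegeneratePoint.

Lemma mxvec_index_inj m n (i i' : 'I_m) (j j' : 'I_n) :
  mxvec_index i j = mxvec_index i' j' -> i = i' /\ j = j'.
Proof. by move/cast_ord_inj/enum_rank_inj=> []. Qed.

Section Nonexistence.
Variable F : numFieldType.

Lemma Q_nonexistence n : (1 < n)%N ->
  ~ exists s : nat -> ratfun F (n * n) (n * n),
      (forall j, (1 <= j <= n)%N -> polynomial_fun (s j)) /\
      (forall k, (k < n)%N -> Q_tau F n (k + n + 1) =
         \sum_(1 <= i < n.+1) Q_tau F n (k + i) * s (n - i + 1)%N).
Proof.
move=> n1 [s [polys eqs]].
pose gen (i j : 'I_n) := mxvec_index i j.
have gen_inj i j i' j' : gen i j = gen i' j' -> i = i' /\ j = j'.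
  exact: mxvec_index_inj.
pose A : 'M[grassmann {mpoly F[n * n]} (n * n)]_n :=
  \matrix_(i, j) ('X_(gen i j) : {mpoly F[n * n]})%:A + \matrix_(i, j) gr_gen _ (gen i j).
have AK : map_mx (gr_spec (@tofrac _) setT) A = Q_matrix F n.
  by rewrite map_mxD toK_even toK_gens; apply/matrixP=> i j; rewrite !mxE.
pose y : 'I_(n * n) -> F := mxvec (special_diag F n) 0.
have AT T : special_mx A y T = gr_lift (n * n) (special_diag F n) + restricted_gens F gen T.
  rewrite /special_mx map_mxD special_even special_gens; congr (gr_lift _ _ + _).
  by apply/matrixP=> i j; rewrite mxE /y /gen mxvecE.
have [|g gE] := specialize_recursion (A := A) (e := id) y polys.
  by rewrite AK; exact: eqs.
apply: (@core_contradiction F (n * n) n 0 gen gen_inj n1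
  (fun T k => k%:R^-1 *: qtr (special_mx A y T ^+ k))
  (fun T j => gr_spec (meval y) T (g j)) (fun j S => (g j S).@[y])) => //.
- by move=> T S j ST; rewrite gr_specE ST.
- by move=> i k; rewrite AT; apply: Q_special1.
- by move=> i j k ij i2 j2; rewrite AT; apply: Q_special3.
Qed.

Lemma Odd_nonexistence n (d := (n * n + n * n)%N) : (1 < n)%N ->
  ~ exists s : nat -> ratfun F d d,
      (forall j, (1 <= j <= n)%N -> polynomial_fun (s j)) /\
      (forall k, (k < n)%N -> Odd_tau F n (k + n + 1) =
         \sum_(1 <= i < n.+1) Odd_tau F n (k + i) * s (n - i + 1)%N).
Proof.
move=> n1 [s [polys eqs]].
pose gen (i j : 'I_n) : 'I_d := lshift (n * n) (mxvec_index i j).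
pose gen' (i j : 'I_n) : 'I_d := rshift (n * n) (mxvec_index i j).
have gen_inj i j i' j' : gen i j = gen i' j' -> i = i' /\ j = j'.
  by move/lshift_inj/mxvec_index_inj.
pose A : 'M[grassmann {mpoly F[d]} d]_(n + n) :=
  block_mx (\matrix_(i, j) gr_gen _ (gen i j))
           (\matrix_(i, j) ('X_(gen i j) : {mpoly F[d]})%:A)
           (\matrix_(i, j) ('X_(gen' i j) : {mpoly F[d]})%:A)
           (\matrix_(i, j) gr_gen _ (gen' i j)).
have AK : map_mx (gr_spec (@tofrac _) setT) A = Odd_matrix F n.
  by rewrite map_block_mx !toK_even !toK_gens.
(* Y' is the degenerate diagonal matrix and Z' the identity, so Y'Z' has the eigenvalues 1, 1, 2,
   ..., n-1. *)
pose y : 'I_d -> F := row_mx (mxvec (special_diag F n)) (mxvec 1%:M) 0.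
(* Only odd coordinates of the block X' are kept; those of T' are set to zero, which leaves a
   companion matrix. *)
have AT (T : {set 'I_d}) : (forall i j, gen' i j \notin T) ->
    special_mx A y T = block_mx (restricted_gens F gen T) (gr_lift d (special_diag F n)) 1%:M 0.
  move=> T'; rewrite /special_mx map_block_mx !special_even !special_gens.
  have -> : \matrix_(i, j) y (gen i j) = special_diag F n.
    by apply/matrixP=> i j; rewrite mxE /y /gen /gen' row_mxEl mxvecE.
  have -> : \matrix_(i, j) y (gen' i j) = 1%:M.
    by apply/matrixP=> i j; rewrite mxE /y /gen /gen' row_mxEr mxvecE.
  have -> : restricted_gens F gen' T = 0.
    by apply/matrixP=> i j; rewrite !mxE (negbTE (T' i j)).
  by rewrite gr_lift1.
have gen'_neq i j k l : gen' i j != gen k l.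
  by rewrite eq_sym eq_lrshift.
have [|g gE] := specialize_recursion (A := A) (e := fun k => (2 * k - 1)%N) y polys.
  move=> k kn; rewrite AK.
  have tauE j : (0 < j)%N ->
      (2 * j - 1)%N%:R^-1 *: qtr (Odd_matrix F n ^+ (2 * j - 1)) = Odd_tau F n j.
    case: j => // j _; rewrite super_par_odd_qtr //; first exact: Odd_matrix_par.
    by rewrite mul2n doubleS subn1 /= odd_double.
  have k1 : (0 < k + n + 1)%N by rewrite addn1.
  rewrite (tauE _ k1) (eqs k kn); apply: eq_big_nat => i /andP[i1 _].
  have ki : (0 < k + i)%N by rewrite addn_gt0 i1 orbT.
  by rewrite (tauE _ ki).
have e2 k : (2 * k.+1 - 1)%N = k.*2.+1 by rewrite mul2n doubleS subn1.
apply: (@core_contradiction F d n 1 gen gen_inj n1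
  (fun T k => (2 * k - 1)%N%:R^-1 *: qtr (special_mx A y T ^+ (2 * k - 1)))
  (fun T j => gr_spec (meval y) T (g j)) (fun j S => (g j S).@[y])) => //.
- by move=> T S j ST; rewrite gr_specE ST.
- move=> i k; rewrite e2 AT; first exact: Odd_special1.
  by move=> i' j'; rewrite inE gen'_neq.
- move=> i j k ij i2 j2; rewrite e2 AT; first exact: Odd_special3.
  by move=> i' j'; rewrite !inE !negb_or !gen'_neq.
Qed.

End Nonexistence.

Theorem theorem24 (R : realType) (M : superspace) (n : nat) (n_ge1 : (1 <= n)%N) :
  (exists s : nat -> ratfun R[i] (superdim M n) (superdim M n),
      (forall j, (1 <= j <= n)%N ->
         gr_even (s j) /\ no_singular_points (@tilde R[i] M n) (s j))
      /\ (forall k, (0 <= k <= n - 1)%N ->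
            tau R[i] M n (k + n + 1) =
            \sum_(1 <= i < n.+1) tau R[i] M n (k + i) * s (n - i + 1)%N))
  /\ ((1 < n)%N ->
      ~ exists s : nat -> ratfun R[i] (superdim M n) (superdim M n),
          (forall j, (1 <= j <= n)%N -> polynomial_fun (s j))
          /\ (forall k, (0 <= k <= n - 1)%N ->
                tau R[i] M n (k + n + 1) =
                \sum_(1 <= i < n.+1) tau R[i] M n (k + i) * s (n - i + 1)%N)).
Proof.
split.
  case: n n_ge1 => // n' _; case: M.
    by have [s [sP eqs]] := Q_existence R[i] n'; exists s; split=> [j _|k _];
      [exact: sP | exact: eqs].
  by have [s [sP eqs]] := Odd_existence R[i] n'; exists s; split=> [j _|k _];
      [exact: sP | exact: eqs].
move=> n_gt1 [s [polys eqs]].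
have eqs' k : (k < n)%N -> tau R[i] M n (k + n + 1) =
    \sum_(1 <= i < n.+1) tau R[i] M n (k + i) * s (n - i + 1)%N.
  by move=> kn; apply: eqs; lia.
case: M s polys {eqs} eqs' => s polys eqs.
  by apply: (Q_nonexistence n_gt1); exists s.
by apply: (Odd_nonexistence n_gt1); exists s.
Qed.
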